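(* Let $X$ be a diffeological space. The following are equivalent: (i) $X$ is elastic. (ii) $X$ has an open cover $\{S_i\to X\}$ by elastic spaces $S_i$.
   Context: DIFFEOLOGICAL SPACES. $\mathcal{E}\mathrm{ucl}$ is the category of open subsets $U\subset\mathbb{R}^n$, $n\ge 0$, and smooth maps. A diffeological space is a set $X$ with, for each $U\in\mathcal{E}\mathrm{ucl}$, a set of maps $U\to X$ called plots, such that constant maps are plots, precomposition of a plot with a smooth map is a plot, and a map that restricts to a plot on each member of an open cover of its domain is a plot. Morphisms are maps whose composition with every plot is a plot. The resulting category $\mathcal{D}\mathrm{flg}$ is complete, cocomplete and cartesian closed. $y:\mathcal{E}\mathrm{ucl}\to\mathcal{D}\mathrm{flg}$ is the full embedding equipping $U$ with all smooth maps as plots. An induction (strong monomorphism) is an injective morphism $f:X\to Y$ such that a map $p:U\to X$ is a plot whenever $f\circ p$ is a plot. OPEN COVERS. The $D$-topology on $X$ is the finest topology for which all plots are continuous; ''open'' refers to it. Open subsets carry the subspace diffeology (plots are the plots of $X$ with image in the subset). An open cover of $X$ is a family of open subsets with union $X$. KAN EXTENSION. For an endofunctor $\hat F$ of $\mathcal{E}\mathrm{ucl}$ let $\mathbb{L}\hat F:\mathcal{D}\mathrm{flg}\to\mathcal{D}\mathrm{flg}$ be the left Kan extension of $y\hat F$ along $y$: $(\mathbb{L}\hat F)X=\operatorname{colim}_{yU\to X}y\hat FU$ (colimit over the category of plots $y\downarrow X$). $\mathbb{L}$ is functorial in natural transformations, and $(\mathbb{L}\hat F)yU\cong y\hat FU$.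 There is a natural morphism $\mu_{\hat F,\hat G}:\mathbb{L}(\hat F\hat G)X\cong\operatorname{colim}_{yU\to X}(\mathbb{L}\hat F)y\hat GU\to(\mathbb{L}\hat F)\operatorname{colim}_{yU\to X}y\hat GU\cong(\mathbb{L}\hat F)(\mathbb{L}\hat G)X$. EUCLIDEAN STRUCTURE. For $U\subset\mathbb{R}^n$: $\hat TU=U\times\mathbb{R}^n$ (usual tangent functor), $\hat T_kU=U\times(\mathbb{R}^n)^k$ ($k$-fold fiber product of $\hat TU$ over $U$), $\hat T^2U=\hat T\hat TU=U\times(\mathbb{R}^n)^3$, $\hat\pi_U(u,u_0)=u$, $\hat\lambda_U(u,u_0)=(u,0,0,u_0)$, $\hat\tau_U(u,u_0,u_1,u_{01})=(u,u_1,u_0,u_{01})$. TANGENT FUNCTOR. $T:=\mathbb{L}\hat T$, $\pi:=\mathbb{L}\hat\pi:T\to 1$, $T_kX:=TX\times_X\cdots\times_XTX$ ($k$ factors, fiber product along $\pi_X$ in $\mathcal{D}\mathrm{flg}$). ELASTIC SPACES. A diffeological space $X$ is elastic if: (E1) for all $k>1$ the natural morphism $\theta_{k,X}:(\mathbb{L}\hat T_k)X\to T_kX$, whose components are induced by the projections $\hat T_k\to\hat T$, is an isomorphism; (E2) with $\theta^2_X:=\mu_{\hat T,\hat T}:(\mathbb{L}\hat T^2)X\to T^2X$, there is a morphism $\tau_X:T^2X\to T^2X$ with $\tau_X\circ\theta^2_X=\theta^2_X\circ(\mathbb{L}\hat\tau)_X$; (E3) $\lambda_X:=\theta^2_X\circ(\mathbb{L}\hat\lambda)_X:TX\to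 T^2X$ is an induction; (E4) for all $k>1$ the natural morphism $\nu_{k,X}=(T\mathrm{pr}_1,\dots,T\mathrm{pr}_k):TT_kX\to T^2X\times_{TX}^{T\pi_X,T\pi_X}\cdots\times_{TX}^{T\pi_X,T\pi_X}T^2X$ ($k$ factors) is injective; (E5) for all positive integers $k_1,\dots,k_n$ the space $T_{k_1}\cdots T_{k_n}X$ satisfies (E1)–(E4). *)

(* Defs.v *)
(* The real numbers are an arbitrary [R : realType]. *)
From HB Require Import structures.
From Stdlib Require Import Relations.
From mathcomp Require Import all_boot all_order all_algebra generic_quotient.
From mathcomp Require Import all_classical all_reals topology normedtype landau derive.
From mathcomp Require Import ring.
Set Implicit Arguments. Unset Strict Implicit. Unset Printing Implicit Defensive.
Import Order.TTheory GRing.Theory Num.Theory.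
Import numFieldNormedType.Exports.
Local Open Scope classical_set_scope.
Local Open Scope ring_scope.
Local Open Scope quotient_scope.

(* Class C^k on A: f is Frechet differentiable at every point of A and all its
   directional derivatives are of class C^(k-1). *)
Fixpoint Ck (R : realType) (V W : normedModType R) (k : nat) (A : set V)
    (f : V -> W) : Prop :=
  if k is k'.+1 then
    (forall x, A x -> differentiable f x) /\
    (forall v, Ck k' A (fun x => 'd f x v))
  else forall x, A x -> {for x, continuous f}.

Section NearDiff.
Variables (R : realType) (V W : normedModType R).
Implicit Types f g : V -> W.

Lemma near_eq_differential f g x : {near x, f =1 g} -> differentiable f x ->
  differentiable g x /\ 'd g x = 'd f x :> (V -> W).
Proof.
move=> fg df; have [dfc /eqaddoP dfo] := (diff_locallyP x f).1 df.
have E : g \o shift x = cst (g x) + 'd f x +o_ 0 id.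
  apply/eqaddoP => e e0; have := dfo e e0.
  have : \forall y \near (0 : V), f (y + x) = g (y + x).
    by rewrite (near_shift x) /=; near=> y; rewrite /= sub0r addrNK; near: y.
  move=> h1 h2; near=> y.
  have h2y : `|(f \o shift x - (cst (f x) + 'd f x)) y| <= e * `|y| by near: y.
  suff -> : (g \o shift x - (cst (g x) + 'd f x)) y =
            (f \o shift x - (cst (f x) + 'd f x)) y by [].
  have e1 : f (y + x) = g (y + x) by near: y.
  have e2 : f x = g x := nbhs_singleton fg.
  change (g (y + x) - (g x + 'd f x y) = f (y + x) - (f x + 'd f x y)).
  by rewrite e1 e2.
have E' := diff_unique dfc E.
split; first apply/diff_locallyP; rewrite E'; by [].
Unshelve. all: by end_near. Qed.
End NearDiff.

Section RowLinear.
Variables (R : realType).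
Definition rcoord m (j : 'I_m) (w : 'rV[R]_m) : R := w 0 j.
Fact rcoord_linear m j : linear (@rcoord m j).
Proof. by move=> a u v; rewrite /rcoord !mxE. Qed.
HB.instance Definition _ m j :=
  GRing.isLinear.Build R 'rV[R]_m R _ (@rcoord m j) (rcoord_linear j).

Lemma rV_linear_continuous n (W : normedModType R) (L : {linear 'rV[R]_n -> W}) :
  continuous L.
Proof.
have -> : (L : _ -> _) = \sum_(j < n) (fun x : 'rV[R]_n => rcoord j x *: L (delta_mx 0 j)).
  apply/funext => x; rewrite {1}[x]row_sum_delta linear_sum fct_sumE.
  by apply: eq_bigr => j _; rewrite linearZ.
move=> x; apply: differentiable_continuous; apply: differentiable_sum => j.
exact/differentiableZl/differentiable_coord.
Qed.

Lemma rcoord_continuous m (j : 'I_m) : continuous (rcoord j).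
Proof. exact: coord_continuous. Qed.
End RowLinear.

Section CkTheory.
Variables (R : realType) (V : normedModType R).
Implicit Types (A : set V).

Lemma Ck_eq k (W : normedModType R) A (f g : V -> W) : open A ->
  (forall x, A x -> f x = g x) -> Ck k A f -> Ck k A g.
Proof.
move=> oA; elim: k f g => [|k IH] f g fg /=.
  move=> cf x Ax.
  rewrite /prop_for /continuous_at -(fg _ Ax).
  apply: cvg_trans (cf x Ax); apply: near_eq_cvg.
  by near=> y; apply: fg; near: y; exact: open_nbhs_nbhs.
have nfg x : A x -> {near x, f =1 g}.
  by move=> Ax; near=> y; apply: fg; near: y; exact: open_nbhs_nbhs.
move=> [df Cf]; split=> [x Ax|v].
  by have [] := near_eq_differential (nfg x Ax) (df x Ax).
apply: IH (Cf v) => x Ax.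
by have [_ ->] := near_eq_differential (nfg x Ax) (df x Ax).
Unshelve. all: by end_near. Qed.

Lemma Ck_pred k (W : normedModType R) A (f : V -> W) : Ck k.+1 A f -> Ck k A f.
Proof.
elim: k f => [|k IH] f [df Cf].
  by move=> x /df; exact: differentiable_continuous.
by split=> // v; apply: IH; exact: Cf.
Qed.

Lemma Ck_cst k (W : normedModType R) A (a : W) : Ck k A (fun=> a).
Proof.
elim: k a => [|k IH] a /=; first by move=> x _; apply: cst_continuous.
split=> [x _|v]; first exact: differentiable_cst.
rewrite (_ : (fun x => _) = fun=> 0) //.
by apply/funext => x; rewrite (diff_cst a x).
Qed.

Lemma Ck_lin k (W : normedModType R) A (L : {linear V -> W}) :
  continuous L -> Ck k A L.
Proof.
move=> cL; case: k => [|k] /=; first by move=> x _; exact: cL.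
split=> [x _|v]; first exact: linear_differentiable.
rewrite (_ : (fun x => _) = fun=> L v); first exact: Ck_cst.
by apply/funext => x; rewrite diff_lin.
Qed.

Lemma CkD k (W : normedModType R) A (f g : V -> W) : open A ->
  Ck k A f -> Ck k A g -> Ck k A (fun x => f x + g x).
Proof.
move=> oA; elim: k f g => [|k IH] f g /=.
  by move=> cf cg x Ax; apply: continuousD; [exact: cf|exact: cg].
move=> [df Cf] [dg Cg]; split=> [x Ax|v].
  by apply: differentiableD; [exact: df|exact: dg].
apply: Ck_eq (IH _ _ (Cf v) (Cg v)) => // x Ax.
exact/esym/(f_equal (fun h : V -> W => h v) (diffD (df _ Ax) (dg _ Ax))).
Qed.

Lemma Ck_sum k (W : normedModType R) A n (f : 'I_n -> V -> W) : open A ->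
  (forall i, Ck k A (f i)) -> Ck k A (fun x => \sum_(i < n) f i x).
Proof.
move=> oA; elim: n f => [|n IH] f Cf.
  under eq_fun do rewrite big_ord0.
  exact: Ck_cst.
under eq_fun do rewrite big_ord_recl.
by apply: CkD => //; exact: IH.
Qed.

Lemma diff_linl (W W' : normedModType R) (L : {linear W -> W'}) (f : V -> W) x :
  continuous L -> differentiable f x ->
  differentiable (fun y => L (f y)) x /\
  forall v, 'd (fun y => L (f y)) x v = L ('d f x v).
Proof.
move=> cL df; have dL := linear_differentiable (f x) cL.
split; first exact: (differentiable_comp df dL).
by move=> v; rewrite (diff_comp df dL) /= (diff_lin _ cL).
Qed.

Lemma Ck_linl k (W W' : normedModType R) A (L : {linear W -> W'}) (f : V -> W) :
  open A -> continuous L -> Ck k A f -> Ck k A (fun x => L (f x)).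
Proof.
move=> oA cL; elim: k f => [|k IH] f /=.
  move=> cf x Ax; apply: (@continuous_comp _ _ _ f L); [exact: cf|exact: cL].
move=> [df Cf]; split=> [x Ax|v].
  by have [] := diff_linl cL (df x Ax).
apply: Ck_eq (IH _ (Cf v)) => // x Ax.
by have [_ ->] := diff_linl cL (df x Ax).
Qed.

Lemma CkM k A (f g : V -> R) : open A ->
  Ck k A f -> Ck k A g -> Ck k A (fun x => f x * g x).
Proof.
move=> oA; elim: k f g => [|k IH] f g.
  by move=> cf cg x Ax; apply: continuousM; [exact: cf|exact: cg].
move=> Cf Cg; have [df Cdf] := Cf; have [dg Cdg] := Cg.
split=> [x Ax|v].
  by apply: differentiableM; [exact: df|exact: dg].
apply: Ck_eq (CkD oA (IH _ _ (Ck_pred Cf) (Cdg v)) (IH _ _ (Ck_pred Cg) (Cdf v))) => // x Ax.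
exact/esym/(f_equal (fun h : V -> R => h v) (diffM (df _ Ax) (dg _ Ax))).
Qed.

Lemma Ck_scalel k (W : normedModType R) A (f : V -> R) (w : W) : open A ->
  Ck k A f -> Ck k A (fun x => f x *: w).
Proof.
move=> oA; elim: k f => [|k IH] f /=.
  by move=> cf x Ax; apply: continuousZl; [exact: cf].
move=> [df Cf]; split=> [x Ax|v]; first exact/differentiableZl/df.
apply: Ck_eq (IH _ (Cf v)) => // x Ax.
exact/esym/(f_equal (fun h : V -> W => h v) (diffZl w (df x Ax))).
Qed.

Lemma diff_coord m (f : V -> 'rV[R]_m) x j : differentiable f x ->
  differentiable (fun y => f y 0 j) x /\
  forall v, 'd (fun y => f y 0 j) x v = 'd f x v 0 j.
Proof. exact: (@diff_linl _ _ (rcoord j)  f x (@rcoord_continuous _ _ _)). Qed.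

Lemma Ck_rowP k m A (f : V -> 'rV[R]_m) : open A ->
  Ck k A f <-> forall j, Ck k A (fun x => f x 0 j).
Proof.
move=> oA; split=> [Cf j|Cf].
  exact: (@Ck_linl k _ _ A (rcoord j) f oA (@rcoord_continuous _ _ _) Cf).
rewrite (_ : f = fun x => \sum_(j < m) f x 0 j *: delta_mx 0 j); last first.
  by apply/funext => x; exact: row_sum_delta.
apply: Ck_sum => // j.
exact: (@Ck_scalel k _ A (fun x => f x 0 j) (delta_mx 0 j)).
Qed.
End CkTheory.

Section CkComp.
Variables (R : realType) (V : normedModType R).

Lemma diff_expand n (W : normedModType R) (g : 'rV[R]_n -> W) x v :
  'd g x v = \sum_(j < n) v 0 j *: 'd g x (delta_mx 0 j).
Proof.
rewrite {1}[v]row_sum_delta linear_sum.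
by apply: eq_bigr => j _; rewrite linearZ.
Qed.

Lemma Ck_compR k m (A : set V) (B : set 'rV[R]_m) (f : V -> 'rV[R]_m)
    (g : 'rV[R]_m -> R) : open A ->
  (forall x, A x -> B (f x)) -> Ck k A f -> Ck k B g ->
  Ck k A (fun x => g (f x)).
Proof.
move=> oA AB; elim: k f g AB => [|k IH] f g AB Cf Cg.
  move=> x Ax; apply: (@continuous_comp _ _ _ f g); first exact: Cf.
  exact/Cg/AB.
have [df Cdf] := Cf; have [dg Cdg] := Cg; split=> [x Ax|v].
  exact: (differentiable_comp (df x Ax) (dg _ (AB _ Ax))).
have := @Ck_sum _ _ k R A m (fun j x => 'd f x v 0 j * 'd g (f x) (delta_mx 0 j)) oA.
move=> H; apply: (Ck_eq oA _ (H _)) => [x Ax|j].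
  transitivity ('d g (f x) ('d f x v)); first by rewrite [RHS]diff_expand.
  exact/esym/(f_equal (fun h : V -> R => h v) (diff_comp (df x Ax) (dg _ (AB _ Ax)))).
apply: CkM => //.
  exact: ((Ck_rowP k _ oA).1 (Cdf v) j).
exact: (IH f (fun y => 'd g y (delta_mx 0 j)) AB (Ck_pred Cf) (Cdg _)).
Qed.

Lemma Ck_comp k m p (A : set V) (B : set 'rV[R]_m) (f : V -> 'rV[R]_m)
    (g : 'rV[R]_m -> 'rV[R]_p) : open A -> open B ->
  (forall x, A x -> B (f x)) -> Ck k A f -> Ck k B g ->
  Ck k A (fun x => g (f x)).
Proof.
move=> oA oB AB Cf Cg; apply/Ck_rowP => // j.
exact: (Ck_compR oA AB Cf ((Ck_rowP k g oB).1 Cg j)).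
Qed.

Lemma Ck_comp_lin k n (A : set V) (f : V -> 'rV[R]_n) m (L : {linear 'rV[R]_n -> 'rV[R]_m}) :
  open A -> Ck k A f -> Ck k A (fun x => L (f x)).
Proof. by move=> oA; apply: Ck_linl => //; exact: rV_linear_continuous. Qed.

End CkComp.

Section Schwarz.
Variables (R : realType) (V : normedModType R).

Lemma is_derive_line (f : V -> R) (x v : V) (s : R) :
  differentiable f (x + s *: v) ->
  is_derive s 1 (fun t : R => f (x + t *: v)) ('d f (x + s *: v) v).
Proof.
move=> df.
have dl : is_diff s (fun t : R => x + t *: v) ( *:%R ^~ v).
  have := is_diffD (is_diff_cst x s) (is_diff_scalel s v).
  by rewrite add0r.
have dfl := differentiable_comp (@ex_diff _ _ _ _ _ _ _ dl) df.
apply: DeriveDef; first exact: diff_derivable.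
rewrite deriveE //.
transitivity ('d f (x + s *: v) ('d (fun t : R => x + t *: v) s 1)).
  exact: (f_equal (fun h : R -> R => h 1) (diff_comp (@ex_diff _ _ _ _ _ _ _ dl) df)).
by congr ('d f _ _); rewrite (f_equal (fun h : R -> V => h 1) (@diff_val _ _ _ _ _ _ _ dl)) scale1r.
Qed.

Lemma MVT0 (g dg : R -> R) (h : R) : 0 < h ->
  (forall s, 0 <= s <= h -> is_derive s 1 g (dg s)) ->
  exists2 c, 0 <= c <= h & g h - g 0 = dg c * h.
Proof.
move=> h0 Hg.
have Hi s : s \in `]0, h[%R -> is_derive s 1 g (dg s).
  by rewrite in_itv /= => /andP[/ltW c0 /ltW ch]; apply: Hg; rewrite c0.
have Hc : {within `[0, h], continuous g}.
  apply: derivable_within_continuous => s.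
  by rewrite in_itv /= => /Hg [].
have [c] := MVT_segment (ltW h0) Hi Hc.
by rewrite in_itv /= subr0 => ch E; exists c.
Qed.

(* Derivative in the direction w of the directional derivative along v. *)
Definition d2 (f : V -> R) x v w := 'd (fun y => 'd f y v) x w.

Lemma rectangle (A : set V) (f : V -> R) x v w (h : R) : Ck 2 A f -> 0 < h ->
  (forall s t, 0 <= s <= h -> 0 <= t <= h -> A (x + s *: v + t *: w)) ->
  exists s t, [/\ 0 <= s <= h, 0 <= t <= h &
    f (x + h *: w + h *: v) - f (x + h *: v) - (f (x + h *: w) - f x) =
    d2 f (x + s *: v + t *: w) v w * h * h].
Proof.
move=> [df Cf] h0 HA.
have hh : 0 <= h <= h by apply/andP; split => //; exact: ltW.
have h00 : 0 <= (0:R) <= h by apply/andP; split => //; exact: ltW.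
have A1 s : 0 <= s <= h -> A (x + h *: w + s *: v).
  by move=> sh; rewrite addrAC; exact: HA.
have A2 s : 0 <= s <= h -> A (x + s *: v).
  by move=> sh; have := HA s 0 sh h00; rewrite scale0r addr0.
pose g s := f (x + h *: w + s *: v) - f (x + s *: v).
have [s sh E] : exists2 c, 0 <= c <= h & g h - g 0 =
    ('d f (x + h *: w + c *: v) v - 'd f (x + c *: v) v) * h.
  apply: MVT0 => // s sh.
  have H1 := is_derive_line (df _ (A1 s sh)).
  have H2 := is_derive_line (df _ (A2 s sh)).
  exact: (is_deriveB H1 H2).
have [dg _] := Cf v.
have [t th E2] : exists2 c, 0 <= c <= h & 'd f (x + s *: v + h *: w) v - 'd f (x + s *: v + 0 *: w) v =
   d2 f (x + s *: v + c *: w) v w * h.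
  apply: (@MVT0 (fun t => 'd f (x + s *: v + t *: w) v)) => // t th.
  exact: (is_derive_line (dg _ (HA s t sh th))).
exists s, t; split => //.
rewrite -E2 scale0r addr0 [x + s *: v + _]addrAC -E /g !scale0r !addr0 //.
Qed.

Lemma Schwarz (A : set V) (f : V -> R) x v w : open A -> Ck 2 A f -> A x ->
  d2 f x v w = d2 f x w v.
Proof.
move=> oA Cf Ax; apply/eqP; apply: contraT => neq.
set a := d2 f x v w in neq *; set b := d2 f x w v in neq *.
pose e := `|a - b| / 2.
have e0 : 0 < e by rewrite divr_gt0 // normr_gt0 subr_eq0.
have [_ Cf1] := Cf.
have cvw u u' : {for x, continuous (fun y => d2 f y u u')}.
  by have [_ C2] := Cf1 u; exact: (C2 u').
have n1 : \forall y \near x, `|a - d2 f y v w| < e.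
  by have /cvgrPdist_lt/(_ e e0) := cvw v w.
have n2 : \forall y \near x, `|b - d2 f y w v| < e.
  by have /cvgrPdist_lt/(_ e e0) := cvw w v.
have n3 : \forall y \near x, A y by exact: open_nbhs_nbhs.
have /nbhs_ballP[d /= d0 Hd] : \forall y \near x,
   [/\ `|a - d2 f y v w| < e, `|b - d2 f y w v| < e & A y].
  by near=> y; split; near: y.
pose N := `|v| + `|w| + 1.
have N0 : 0 < N by rewrite ltr_wpDl // addr_ge0.
pose h := d / (2 * N).
have h0 : 0 < h by rewrite divr_gt0 // mulr_gt0.
have near_pt s t : 0 <= s <= h -> 0 <= t <= h -> ball x d (x + s *: v + t *: w).
  move=> /andP[s0 sh] /andP[t0 th]; rewrite -ball_normE /= -addrA opprD addNKr.
  rewrite normrN (le_lt_trans (ler_normD _ _)) // !normrZ !ger0_norm //.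
  have : s * `|v| + t * `|w| <= h * N.
    rewrite /N !mulrDr mulr1 ler_wpDr ?(ltW h0) // lerD // ler_wpM2r //.
  move/le_lt_trans; apply; rewrite /h invfM mulrA -mulrA mulVf ?gt_eqF // mulr1.
  by rewrite ltr_pdivrMr // ltr_pMr // ltr1n.
have [s [t [sh th E]]] := @rectangle A f x v w h Cf h0
   (fun s t sh th => let: And3 _ _ Ay := Hd _ (near_pt s t sh th) in Ay).
have near_pt' s' t' : 0 <= s' <= h -> 0 <= t' <= h -> ball x d (x + s' *: w + t' *: v).
  by move=> ? ?; rewrite addrAC; apply: near_pt.
have [s' [t' [sh' th' E']]] := @rectangle A f x w v h Cf h0
   (fun s t sh th => let: And3 _ _ Ay := Hd _ (near_pt' s t sh th) in Ay).
have E3 : d2 f (x + s *: v + t *: w) v w = d2 f (x + s' *: w + t' *: v) w v.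
  apply: (mulIf (lt0r_neq0 h0)); apply: (mulIf (lt0r_neq0 h0)).
  by rewrite -E -E' [x + h *: v + h *: w]addrAC; ring.
have [P1 _ _] := Hd _ (near_pt s t sh th).
have [_ P2 _] := Hd _ (near_pt' s' t' sh' th').
have : `|a - b| < e + e.
  rewrite -(subrK (d2 f (x + s *: v + t *: w) v w) a) -addrA.
  apply: le_lt_trans (ler_normD _ _) _; apply: ltrD => //.
  by rewrite E3 distrC.
by rewrite -splitr ltxx.
Unshelve. all: by end_near. Qed.

End Schwarz.

Section TangentMap.
Variable R : realType.

Lemma Ck_rV_lin k n m (A : set 'rV[R]_n) (L : {linear 'rV[R]_n -> 'rV[R]_m}) :
  Ck k A L.
Proof. exact/Ck_lin/rV_linear_continuous. Qed.

Lemma diff_sumE (V : normedModType R) n (F : 'I_n -> V -> R) x v :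
  (forall i, differentiable (F i) x) ->
  differentiable (fun y => \sum_(i < n) F i y) x /\
  'd (fun y => \sum_(i < n) F i y) x v = \sum_(i < n) 'd (F i) x v.
Proof.
elim: n F => [|n IH] F dF.
  under eq_fun do rewrite big_ord0.
  by split; [exact: differentiable_cst|rewrite big_ord0 (diff_cst 0 x)].
under eq_fun do rewrite big_ord_recl.
have [dS E] := IH _ (fun i => dF (lift ord0 i)).
split; first exact: (differentiableD (dF ord0) dS).
rewrite big_ord_recl -E.
exact: (f_equal (fun h : V -> R => h v) (diffD (dF ord0) dS)).
Qed.

(* (u, v) |-> (f u, Df(u) v), with the pair (u, v) encoded as [row_mx u v]. *)
Definition tanf n m (f : 'rV[R]_n -> 'rV[R]_m) (w : 'rV[R]_(n + n)) : 'rV[R]_(m + m) :=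
  row_mx (f (lsubmx w)) ('d f (lsubmx w) (rsubmx w)).

(* (u, v_1, .., v_k) |-> (f u, Df(u) v_1, .., Df(u) v_k); the v_i are the rows
   of a k x n matrix, flattened by [mxvec]. *)
Definition tankf k n m (f : 'rV[R]_n -> 'rV[R]_m) (w : 'rV[R]_(n + k * n)) :
    'rV[R]_(m + k * m) :=
  row_mx (f (lsubmx w))
    (mxvec (\matrix_(i < k) 'd f (lsubmx w) (row i (vec_mx (rsubmx w))))).

Lemma open_lsubmx n p (A : set 'rV[R]_n) : open A ->
  open [set w : 'rV[R]_(n + p) | A (lsubmx w)].
Proof.
move=> oA; apply: (@open_comp _ _ (lsubmx : 'rV[R]_(n + p) -> 'rV[R]_n)) => // w _.
exact: rV_linear_continuous.
Qed.

Lemma Ck_diff_pair k n m p (A : set 'rV[R]_n) (f : 'rV[R]_n -> 'rV[R]_m)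
    (L : {linear 'rV[R]_(n + p) -> 'rV[R]_n}) : open A ->
  Ck k.+1 A f ->
  Ck k [set w : 'rV[R]_(n + p) | A (lsubmx w)] (fun w => 'd f (lsubmx w) (L w)).
Proof.
move=> oA [_ Cf]; have oB := @open_lsubmx n p A oA.
have CL := Ck_rV_lin k [set w : 'rV[R]_(n + p) | A (lsubmx w)] L.
have Cl := Ck_rV_lin k [set w : 'rV[R]_(n + p) | A (lsubmx w)] (@lsubmx R 1 n p).
apply/Ck_rowP => // j.
have H := @Ck_sum _ _ k _ _ n (fun i (w : 'rV[R]_(n + p)) =>
  (L w) 0 i * ('d f (lsubmx w) (delta_mx 0 i)) 0 j) oB.
apply: (Ck_eq oB _ (H _)) => [w Aw|i].
  rewrite [in RHS]diff_expand summxE; apply: eq_bigr => i _; by rewrite mxE.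
apply: CkM => //; first exact: ((Ck_rowP k L oB).1 CL i).
have := @Ck_comp _ _ k n m _ A _ _ oB oA _ Cl (Cf (delta_mx 0 i)).
by move=> H'; exact: ((Ck_rowP k _ oB).1 (H' _) j).
Qed.

Lemma Ck_row_mx k (V : normedModType R) m p (A : set V) (f : V -> 'rV[R]_m) (g : V -> 'rV[R]_p) :
  open A -> Ck k A f -> Ck k A g -> Ck k A (fun x => row_mx (f x) (g x)).
Proof.
move=> oA Cf Cg; apply/Ck_rowP => // j; case: (fintype.splitP j) => i ji; [have {ji} -> : j = lshift _ i by exact: val_inj | have {ji} -> : j = rshift _ i by exact: val_inj].
  by under eq_fun do rewrite row_mxEl; exact: ((Ck_rowP k f oA).1 Cf i).
by under eq_fun do rewrite row_mxEr; exact: ((Ck_rowP k g oA).1 Cg i).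
Qed.

Lemma Ck_base k n m p (A : set 'rV[R]_n) (f : 'rV[R]_n -> 'rV[R]_m) : open A ->
  Ck k A f -> Ck k [set w : 'rV[R]_(n + p) | A (lsubmx w)] (fun w => f (lsubmx w)).
Proof.
move=> oA Cf; apply: (@Ck_comp _ _ k n m _ A (fun w : 'rV[R]_(n + p) => lsubmx w) f) => //.
  exact: open_lsubmx.
exact: (Ck_rV_lin k _ (@lsubmx R 1 n p)).
Qed.

Lemma Ck_tanf k n m (A : set 'rV[R]_n) (f : 'rV[R]_n -> 'rV[R]_m) : open A ->
  Ck k.+1 A f -> Ck k [set w | A (lsubmx w)] (tanf f).
Proof.
move=> oA Cf; apply: Ck_row_mx; first exact: open_lsubmx.
  exact/Ck_base/Ck_pred.
exact: (@Ck_diff_pair k n m n A f (@rsubmx R 1 n n)).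
Qed.

Definition tcomp k n (i : 'I_k) (w : 'rV[R]_(n + k * n)) : 'rV[R]_n :=
  row i (vec_mx (rsubmx w)).
Fact tcomp_linear k n i : linear (@tcomp k n i).
Proof. by move=> a u v; rewrite /tcomp !linearP. Qed.
HB.instance Definition _ k n i :=
  GRing.isLinear.Build R 'rV[R]_(n + k * n) 'rV[R]_n _ (@tcomp k n i) (tcomp_linear i).

Lemma Ck_tankf k l n m (A : set 'rV[R]_n) (f : 'rV[R]_n -> 'rV[R]_m) : open A ->
  Ck k.+1 A f -> Ck k [set w | A (lsubmx w)] (@tankf l _ _ f).
Proof.
move=> oA Cf; have oB := @open_lsubmx n (l * n) A oA; apply: Ck_row_mx => //.
  exact/Ck_base/Ck_pred.
apply/Ck_rowP => // j; case/mxvec_indexP: j => i j.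
rewrite (_ : (fun x => _) = fun x => ('d f (lsubmx x) (tcomp i x)) 0 j); last first.
  by apply/funext => x; rewrite [LHS]mxvecE mxE.
have C := @Ck_diff_pair k n m (l * n) A f (@tcomp l n i) oA Cf.
exact: ((Ck_rowP k _ oB).1 C j).
Qed.

Lemma diff_eq_on n (W : normedModType R) (A : set 'rV[R]_n) (f g : 'rV[R]_n -> W) x : open A ->
  A x -> {in A, f =1 g} -> differentiable f x ->
  'd f x = 'd g x :> (_ -> _).
Proof.
move=> oA Ax fg df.
have nfg : {near x, f =1 g}.
  by near=> y; apply: fg; rewrite inE; near: y; exact: open_nbhs_nbhs.
by have [_ E] := near_eq_differential nfg df; exact: (esym E).
Unshelve. all: by end_near. Qed.

Lemma d2_row n m (A : set 'rV[R]_n) (f : 'rV[R]_n -> 'rV[R]_m) x a b j :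
  open A -> Ck 2 A f -> A x ->
  ('d (fun y => 'd f y a) x b) 0 j = d2 (fun y => f y 0 j) x a b.
Proof.
move=> oA [df Cf] Ax; have [daf _] := Cf a.
have [_ <-] := diff_coord j (daf _ Ax).
have E : {in A, (fun y => 'd f y a 0 j) =1 (fun y => 'd (fun z => f z 0 j) y a)}.
  by move=> y /set_mem Ay; have [_ <-] := diff_coord j (df _ Ay).
have [dj _] := diff_coord j (daf _ Ax).
exact: (f_equal (fun h : _ -> _ => h b) (diff_eq_on oA Ax E dj)).
Qed.

Lemma Schwarz_row n m (A : set 'rV[R]_n) (f : 'rV[R]_n -> 'rV[R]_m) x a b :
  open A -> Ck 2 A f -> A x ->
  'd (fun y => 'd f y a) x b = 'd (fun y => 'd f y b) x a.
Proof.
move=> oA Cf Ax; apply/rowP => j; rewrite !(d2_row _ _ _ oA Cf Ax).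
exact: (Schwarz _ _ oA ((Ck_rowP 2 f oA).1 Cf j) Ax).
Qed.

Lemma tanf2 n m (A : set 'rV[R]_n) (f : 'rV[R]_n -> 'rV[R]_m) u u0 u1 u01 :
  open A -> Ck 2 A f -> A u ->
  tanf (tanf f) (row_mx (row_mx u u0) (row_mx u1 u01)) =
  row_mx (row_mx (f u) ('d f u u0))
         (row_mx ('d f u u1) ('d (fun y => 'd f y u0) u u1 + 'd f u u01)).
Proof.
move=> oA Cf Au; rewrite {1}/tanf !row_mxKl !row_mxKr; congr row_mx.
  by rewrite /tanf row_mxKl row_mxKr.
set w := row_mx u u0; set w' := row_mx u1 u01.
have lw : lsubmx w = u by rewrite row_mxKl.
have rw : rsubmx w = u0 by rewrite row_mxKr.
have [dft _] : Ck 1 [set w | A (lsubmx w)] (tanf f) by exact: Ck_tanf.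
have dw : differentiable (tanf f) w by apply: dft; rewrite /= lw.
have [df Cdf] := Cf.
have dl (y : 'rV[R]_(n + n)) : differentiable (lsubmx : _ -> 'rV[R]_n) y by exact: differentiable_lsubmx.
apply/rowP => j; case: (fintype.splitP j) => i ji; [have {ji} -> : j = lshift _ i by exact: val_inj | have {ji} -> : j = rshift _ i by exact: val_inj].
  rewrite row_mxEl; have [_ <-] := diff_coord (lshift m i) dw.
  have -> : (fun y => tanf f y 0 (lshift m i)) = fun y => (f (lsubmx y)) 0 i.
    by apply/funext => y; rewrite /tanf row_mxEl.
  have dfw : differentiable f (lsubmx w) by rewrite lw; exact: df.
  have dfl : differentiable (f \o lsubmx) w.
    exact: differentiable_comp (dl w) dfw.
  have dL : 'd lsubmx w w' = u1.
    transitivity (lsubmx w'); last by rewrite row_mxKl.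
    exact: (f_equal (fun h : _ -> _ => h w') (diff_lin w (@rV_linear_continuous R _ _ (@lsubmx R 1 n n)))).
  have Ec : 'd (f \o lsubmx) w w' = 'd f (lsubmx w) ('d lsubmx w w').
    exact: (f_equal (fun h : 'rV[R]_(n + n) -> 'rV[R]_m => h w') (diff_comp (dl w) dfw)).
  have [_ Ed] := diff_coord i dfl.
  transitivity ('d (f \o lsubmx) w w' 0 i); first exact: Ed.
  by rewrite Ec dL lw.
rewrite row_mxEr; have [_ <-] := diff_coord (rshift m i) dw.
pose phi l x : R := ('d f x (delta_mx 0 l)) 0 i.
pose crd (l : 'I_n) (y : 'rV[R]_(n + n)) : R := rsubmx y 0 l.
have dphi l x : A x -> differentiable (phi l) x.
  by move=> Ax; have [d1 _] := Cdf (delta_mx 0 l); have [] := diff_coord i (d1 _ Ax).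
have dL : 'd lsubmx w w' = u1.
  transitivity (lsubmx w'); last by rewrite row_mxKl.
  exact: (f_equal (fun h : _ -> _ => h w') (diff_lin w (@rV_linear_continuous R _ _ (@lsubmx R 1 n n)))).
have dR : 'd rsubmx w w' = u01.
  transitivity (rsubmx w'); last by rewrite row_mxKr.
  exact: (f_equal (fun h : _ -> _ => h w') (diff_lin w (@rV_linear_continuous R _ _ (@rsubmx R 1 n n)))).
have dcrd l : differentiable (crd l) w /\ 'd (crd l) w w' = u01 0 l.
  have [d1 E] := diff_coord l (@differentiable_rsubmx R 1 n n w).
  split; first exact: d1.
  transitivity ('d rsubmx w w' 0 l); first exact: E.
  by rewrite dR.
have dphil l : differentiable (phi l \o lsubmx) w /\ 'd (phi l \o lsubmx) w w' = 'd (phi l) u u1.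
  have d1 : differentiable (phi l) (lsubmx w) by rewrite lw; exact: dphi.
  split; first exact: differentiable_comp (dl w) d1.
  transitivity ('d (phi l) (lsubmx w) ('d lsubmx w w')).
    exact: (f_equal (fun h : 'rV[R]_(n + n) -> R => h w') (diff_comp (dl w) d1)).
  by rewrite dL lw.
have -> : (fun y => tanf f y 0 (rshift m i)) =
    fun y => \sum_(l < n) (crd l * (phi l \o lsubmx)) y.
  apply/funext => y; rewrite /tanf row_mxEr diff_expand summxE.
  by apply: eq_bigr => l _; rewrite mxE.
have dprod l : differentiable (crd l * (phi l \o lsubmx)) w.
  by apply: differentiableM; [have [] := dcrd l|have [] := dphil l].
have [_ ->] := @diff_sumE _ _ (fun l => crd l * (phi l \o lsubmx)) w w' dprod.
have E l : 'd (crd l * (phi l \o lsubmx)) w w' =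
    u0 0 l * 'd (phi l) u u1 + u01 0 l * phi l u.
  have [d1 E1] := dcrd l; have [d2 E2] := dphil l.
  transitivity (crd l w * 'd (phi l \o lsubmx) w w' + (phi l \o lsubmx) w * 'd (crd l) w w').
    exact: (f_equal (fun h : _ -> R => h w') (diffM d1 d2)).
  by rewrite E1 E2 /crd rw /= lw [phi l u * _]mulrC.
under eq_bigr do rewrite E.
rewrite big_split /= mxE; congr (_ + _); last first.
  by rewrite diff_expand summxE; apply: eq_bigr => l _; rewrite mxE.
have [d1 _] := Cdf u0.
have [_ <-] := diff_coord i (d1 _ Au).
have dz l : differentiable (fun x => u0 0 l *: phi l x) u.
  exact/(differentiableZ (u0 0 l))/dphi.
have -> : (fun y => 'd f y u0 0 i) = fun y => \sum_(l < n) (u0 0 l *: phi l y).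
  apply/funext => y; rewrite diff_expand summxE.
  by apply: eq_bigr => l _; rewrite mxE.
have [_ ->] := @diff_sumE _ _ (fun l y => u0 0 l *: phi l y) u u1 dz.
apply: eq_bigr => l _; apply: esym.
exact: (f_equal (fun h : _ -> R => h u1) (diffZ (u0 0 l) (dphi l u Au))).
Qed.

Lemma Ck_local k n m (A : set 'rV[R]_n) (f : 'rV[R]_n -> 'rV[R]_m) :
  (forall x, A x -> exists B, B x /\ Ck k B f) -> Ck k A f.
Proof.
elim: k f => [|k IH] f H.
  by move=> x Ax; have [B [Bx CB]] := H x Ax; exact: CB.
split=> [x Ax|v]; first by have [B [Bx [dB _]]] := H x Ax; exact: dB.
by apply: IH => x Ax; have [B [Bx [_ CB]]] := H x Ax; exists B; split=> //; exact: CB.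
Qed.

Lemma Ck_sub k n m (A B : set 'rV[R]_n) (f : 'rV[R]_n -> 'rV[R]_m) :
  A `<=` B -> Ck k B f -> Ck k A f.
Proof.
move=> AB; elim: k f => [|k IH] f /=; first by move=> cf x /AB; exact: cf.
by move=> [df Cf]; split=> [x /AB|v]; [exact: df|exact: IH].
Qed.
End TangentMap.

(* Objects of the category of open subsets of the spaces R^n, n >= 0. *)
Record eucl (R : realType) := Eucl {
  edim : nat;
  edom : set 'rV[R]_edim;
  edom_open : open edom }.
Arguments Eucl {R edim edom}.
Arguments edom {R}.
Arguments edom_open {R}.

Definition epts (R : realType) (U : eucl R) : Type := set_type (edom U).
Coercion epts : eucl >-> Sortclass.

Section EuclPoints.
Variable R : realType.
Implicit Types U V W : eucl R.

Definition ecoord U (u : U) : 'rV[R]_(edim U) := val u.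

Definition mkpt U (x : 'rV[R]_(edim U)) (Ux : edom U x) : U :=
  exist _ x (mem_set Ux).

Lemma ecoordP U (u : U) : edom U (ecoord u).
Proof. exact/set_mem/(valP u). Qed.

Lemma ecoord_inj U : injective (@ecoord U).
Proof. exact: val_inj. Qed.

(* Extension by 0 outside U. As U is open, differentiability and derivatives at
   points of U do not depend on the values outside U. *)
Definition ext U V (f : U -> V) (x : 'rV[R]_(edim U)) : 'rV[R]_(edim V) :=
  oapp (fun u : U => ecoord (f u)) 0 (insub x).

Lemma extE U V (f : U -> V) (u : U) : ext f (ecoord u) = ecoord (f u).
Proof. by rewrite /ext /ecoord valK. Qed.

Lemma ext_in U V (f : U -> V) x (Ux : edom U x) : ext f x = ecoord (f (mkpt Ux)).
Proof. by rewrite -(extE f (mkpt Ux)). Qed.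

Lemma ext_dom U V (f : U -> V) x : edom U x -> edom V (ext f x).
Proof. by move=> Ux; rewrite (ext_in f Ux); exact: ecoordP. Qed.

Definition smooth U V (f : U -> V) : Prop := forall k, Ck k (edom U) (ext f).

Lemma smooth_total U V (f : U -> V) (g : 'rV[R]_(edim U) -> 'rV[R]_(edim V)) :
  (forall u, ecoord (f u) = g (ecoord u)) ->
  (forall k, Ck k (edom U) g) -> smooth f.
Proof.
move=> fg Cg k; apply: (Ck_eq (edom_open U) _ (Cg k)) => x Ux.
by rewrite (ext_in f Ux) fg.
Qed.

Lemma smooth_id U : smooth (@id U).
Proof.
apply: (@smooth_total _ _ _ id) => // k.
exact: (Ck_rV_lin k (edom U) idfun).
Qed.

Lemma smooth_comp U V W (g : V -> W) (f : U -> V) :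
  smooth g -> smooth f -> smooth (g \o f).
Proof.
move=> Sg Sf k.
have H : forall x, edom U x -> edom V (ext f x) by move=> x; exact: ext_dom.
apply: (Ck_eq (edom_open U) _
  (Ck_comp (edom_open U) (edom_open V) H (Sf k) (Sg k))) => x Ux.
by rewrite (ext_in f Ux) extE (ext_in (g \o f) Ux).
Qed.

Lemma smooth_cst U V (v : V) : smooth (fun _ : U => v).
Proof.
by apply: (@smooth_total _ _ _ (fun=> ecoord v)) => // k; exact: Ck_cst.
Qed.
End EuclPoints.

Record ehom (R : realType) (U V : eucl R) := Ehom {
  efun :> U -> V;
  ehomP : smooth efun }.
Arguments Ehom {R U V}.
Arguments ehomP {R U V}.

Section EuclCategory.
Variable R : realType.
Implicit Types U V W : eucl R.

Lemma ehom_eq U V (f g : ehom U V) : f =1 g -> f = g.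
Proof.
case: f g => [f Sf] [g Sg] /= /funext fg; move: Sf; rewrite fg => Sf.
by congr Ehom; exact: Prop_irrelevance.
Qed.

Definition eid U : ehom U U := Ehom id (@smooth_id R U).

Definition ecomp U V W (g : ehom V W) (f : ehom U V) : ehom U W :=
  Ehom (g \o f) (smooth_comp (ehomP g) (ehomP f)).

Definition incl U (A : set 'rV[R]_(edim U)) (oA : open A) (AU : A `<=` edom U)
  (a : Eucl oA) : U := mkpt (AU _ (ecoordP a)).

Lemma incl_smooth U A (oA : open A) (AU : A `<=` edom U) : smooth (@incl U A oA AU).
Proof.
apply: (@smooth_total _ _ _ _ id) => // k.
exact: (Ck_rV_lin k A idfun).
Qed.

Definition eincl U A (oA : open A) (AU : A `<=` edom U) : ehom (Eucl oA) U :=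
  Ehom (incl AU) (incl_smooth oA AU).
End EuclCategory.

Record endofunctor (R : realType) := Endofunctor {
  Fob :> eucl R -> eucl R;
  Fmor : forall U V, ehom U V -> ehom (Fob U) (Fob V);
  Fmor_id : forall U, Fmor (eid U) = eid (Fob U);
  Fmor_comp : forall U V W (g : ehom V W) (f : ehom U V),
    Fmor (ecomp g f) = ecomp (Fmor g) (Fmor f) }.

Arguments Fmor {R} e {U V}.

Record nattrans (R : realType) (F G : endofunctor R) := Nattrans {
  ncomp :> forall U, ehom (F U) (G U);
  ncompP : forall U V (f : ehom U V),
    ecomp (ncomp V) (Fmor F f) = ecomp (Fmor G f) (ncomp U) }.

Section FunctorCategory.
Variable R : realType.
Definition functor_id : endofunctor R :=
  @Endofunctor R id (fun U V f => f) (fun U => erefl) (fun U V W g f => erefl).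

Section Comp.
Variables F G : endofunctor R.
Let mor U V (f : ehom U V) : ehom (F (G U)) (F (G V)) := Fmor F (Fmor G f).
Let mor_id U : mor (eid U) = eid (F (G U)).
Proof. by rewrite /mor !Fmor_id. Qed.
Let mor_comp U V W (g : ehom V W) (f : ehom U V) :
  mor (ecomp g f) = ecomp (mor g) (mor f).
Proof. by rewrite /mor !Fmor_comp. Qed.
Definition functor_comp : endofunctor R := Endofunctor mor_id mor_comp.
End Comp.
End FunctorCategory.

Section TangentFunctors.
Variable R : realType.
Implicit Types U V W : eucl R.

Definition tan_ob U : eucl R :=
  Eucl (@open_lsubmx R (edim U) (edim U) _ (edom_open U)).

Definition tank_ob (k : nat) U : eucl R :=
  Eucl (@open_lsubmx R (edim U) (k * edim U) _ (edom_open U)).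

Lemma tan_funP U V (f : U -> V) (w : tan_ob U) :
  edom (tan_ob V) (tanf (ext f) (ecoord w)).
Proof. by rewrite /= /tanf row_mxKl; apply: ext_dom; exact: (ecoordP w). Qed.

Definition tan_fun U V (f : U -> V) (w : tan_ob U) : tan_ob V :=
  mkpt (tan_funP f w).

Lemma tan_fun_smooth U V (f : ehom U V) : smooth (tan_fun f).
Proof.
apply: (@smooth_total R (tan_ob U) (tan_ob V) _ (tanf (ext f))) => // k.
by apply: Ck_tanf; [exact: edom_open|exact: ehomP].
Qed.

Definition tan_mor U V (f : ehom U V) : ehom (tan_ob U) (tan_ob V) :=
  Ehom (tan_fun f) (tan_fun_smooth f).

Lemma tank_funP k U V (f : U -> V) (w : tank_ob k U) :
  edom (tank_ob k V) (tankf (ext f) (ecoord w)).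
Proof. by rewrite /= /tankf row_mxKl; apply: ext_dom; exact: (ecoordP w). Qed.

Definition tank_fun k U V (f : U -> V) (w : tank_ob k U) : tank_ob k V :=
  mkpt (tank_funP f w).

Lemma tank_fun_smooth k U V (f : ehom U V) : smooth (@tank_fun k _ _ f).
Proof.
apply: (@smooth_total R (tank_ob k U) (tank_ob k V) _ (tankf (ext f))) => // l.
by apply: Ck_tankf; [exact: edom_open|exact: ehomP].
Qed.

Definition tank_mor k U V (f : ehom U V) : ehom (tank_ob k U) (tank_ob k V) :=
  Ehom (@tank_fun k _ _ f) (tank_fun_smooth k f).

Lemma ehom_differentiable U V (f : ehom U V) x :
  edom U x -> differentiable (ext f) x.
Proof. by have [df _] := ehomP f 1 => Ux; exact: df. Qed.

Lemma ext_eid U x : edom U x -> ext (eid U) x = x.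
Proof. by move=> Ux; rewrite (ext_in _ Ux). Qed.

Lemma ext_ecomp U V W (g : ehom V W) (f : ehom U V) x : edom U x ->
  ext (ecomp g f) x = ext g (ext f x).
Proof. by move=> Ux; rewrite (ext_in _ Ux) (ext_in f Ux) extE. Qed.

Lemma diff_eid U x : edom U x -> forall v, 'd (ext (eid U)) x v = v.
Proof.
move=> Ux v; have E : {in edom U, ext (eid U) =1 id}.
  by move=> y /set_mem Uy; exact: ext_eid.
transitivity ('d (@id 'rV[R]_(edim U)) x v).
  exact: (f_equal (fun h : _ -> _ => h v)
     (diff_eq_on (edom_open U) Ux E (ehom_differentiable (eid U) Ux))).
exact: (f_equal (fun h : _ -> _ => h v) (@diff_val _ _ _ _ _ _ _ (is_diff_id x))).
Qed.

Lemma diff_ecomp U V W (g : ehom V W) (f : ehom U V) x : edom U x -> forall v,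
  'd (ext (ecomp g f)) x v = 'd (ext g) (ext f x) ('d (ext f) x v).
Proof.
move=> Ux v; have E : {in edom U, ext (ecomp g f) =1 ext g \o ext f}.
  by move=> y /set_mem Uy; exact: ext_ecomp.
transitivity ('d (ext g \o ext f) x v).
  exact: (f_equal (fun h : _ -> _ => h v)
     (diff_eq_on (edom_open U) Ux E (ehom_differentiable (ecomp g f) Ux))).
exact: (f_equal (fun h : _ -> _ => h v) (diff_comp (ehom_differentiable f Ux)
   (ehom_differentiable g (ext_dom f Ux)))).
Qed.

Lemma tan_mor_id U : tan_mor (eid U) = eid (tan_ob U).
Proof.
apply: ehom_eq => w; apply: ecoord_inj; have Ux : edom U _ := ecoordP w.
change (tanf (ext (eid U)) (ecoord w) = ecoord w).
by rewrite /tanf ext_eid // diff_eid // hsubmxK.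
Qed.

Lemma tan_mor_comp U V W (g : ehom V W) (f : ehom U V) :
  tan_mor (ecomp g f) = ecomp (tan_mor g) (tan_mor f).
Proof.
apply: ehom_eq => w; apply: ecoord_inj; have Ux : edom U _ := ecoordP w.
change (tanf (ext (ecomp g f)) (ecoord w) = tanf (ext g) (tanf (ext f) (ecoord w))).
by rewrite /tanf ext_ecomp // diff_ecomp // row_mxKl row_mxKr.
Qed.

Lemma tank_mor_id k U : tank_mor k (eid U) = eid (tank_ob k U).
Proof.
apply: ehom_eq => w; apply: ecoord_inj; have Ux : edom U _ := ecoordP w.
change (tankf (ext (eid U)) (ecoord w) = ecoord w).
rewrite /tankf ext_eid // -[RHS]hsubmxK; congr row_mx.
rewrite -[RHS]vec_mxK; congr mxvec; apply/row_matrixP => i.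
by rewrite rowK diff_eid.
Qed.

Lemma tank_mor_comp k U V W (g : ehom V W) (f : ehom U V) :
  tank_mor k (ecomp g f) = ecomp (tank_mor k g) (tank_mor k f).
Proof.
apply: ehom_eq => w; apply: ecoord_inj; have Ux : edom U _ := ecoordP w.
change (tankf (ext (ecomp g f)) (ecoord w) = tankf (ext g) (tankf (ext f) (ecoord w))).
rewrite /tankf ext_ecomp // row_mxKl row_mxKr mxvecK; congr row_mx.
congr mxvec; apply/row_matrixP => i.
by rewrite !rowK diff_ecomp.
Qed.

Definition That : endofunctor R := Endofunctor tan_mor_id tan_mor_comp.
Definition Tkhat k : endofunctor R := Endofunctor (tank_mor_id k) (tank_mor_comp k).
(* The point (u, u_0, u_1, u_01) of T^2 U is [row_mx (row_mx u u_0) (row_mx u_1 u_01)]. *)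
Definition T2hat : endofunctor R := functor_comp That That.

Definition pihat_fun U (w : That U) : U := @mkpt R U (lsubmx (ecoord w)) (ecoordP w).
Lemma pihat_smooth U : smooth (@pihat_fun U).
Proof.
apply: (@smooth_total R (tan_ob U) U _ lsubmx) => // k.
exact: (Ck_rV_lin k _ (@lsubmx R 1 _ _)).
Qed.
Definition pihat_comp U : ehom (That U) (functor_id R U) := Ehom _ (@pihat_smooth U).
Lemma pihatP U V (f : ehom U V) :
  ecomp (pihat_comp V) (Fmor That f) = ecomp (Fmor (functor_id R) f) (pihat_comp U).
Proof.
apply: ehom_eq => w; apply: ecoord_inj.
change (lsubmx (tanf (ext f) (ecoord w)) = ecoord (f (pihat_fun w))).
by rewrite /tanf row_mxKl -extE.
Qed.
Definition pihat : nattrans That (functor_id R) := Nattrans pihatP.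

Definition prhatf k n (i : 'I_k) (w : 'rV[R]_(n + k * n)) : 'rV[R]_(n + n) :=
  row_mx (lsubmx w) (row i (vec_mx (rsubmx w))).
Lemma prhat_funP k (i : 'I_k) U (w : Tkhat k U) : edom (That U) (prhatf i (ecoord w)).
Proof. by rewrite /= /prhatf row_mxKl; exact: (ecoordP w). Qed.
Definition prhat_fun k i U (w : Tkhat k U) : That U := mkpt (prhat_funP i w).
Lemma prhat_smooth k i U : smooth (@prhat_fun k i U).
Proof.
apply: (@smooth_total R (tank_ob k U) (tan_ob U) _ (prhatf i)) => // l.
apply: Ck_row_mx; first exact: (edom_open (tank_ob k U)).
  exact: (Ck_rV_lin l _ (@lsubmx R 1 _ _)).
exact: (Ck_rV_lin l _ (@tcomp R k _ i)).
Qed.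
Definition prhat_comp k i U : ehom (Tkhat k U) (That U) := Ehom _ (@prhat_smooth k i U).
Lemma prhatP k i U V (f : ehom U V) :
  ecomp (@prhat_comp k i V) (Fmor (Tkhat k) f) = ecomp (Fmor That f) (prhat_comp i U).
Proof.
apply: ehom_eq => w; apply: ecoord_inj.
change (prhatf i (tankf (ext f) (ecoord w)) = tanf (ext f) (prhatf i (ecoord w))).
by rewrite /tanf /prhatf /tankf !row_mxKl !row_mxKr mxvecK rowK.
Qed.
Definition prhat k (i : 'I_k) : nattrans (Tkhat k) That := Nattrans (prhatP i).

Definition lambdahatf n (w : 'rV[R]_(n + n)) : 'rV[R]_((n + n) + (n + n)) :=
  row_mx (row_mx (lsubmx w) 0) (row_mx 0 (rsubmx w)).
Lemma lambdahat_funP U (w : That U) : edom (T2hat U) (lambdahatf (ecoord w)).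
Proof. by rewrite /= /lambdahatf !row_mxKl; exact: (ecoordP w). Qed.
Definition lambdahat_fun U (w : That U) : T2hat U := mkpt (lambdahat_funP w).
Lemma lambdahat_smooth U : smooth (@lambdahat_fun U).
Proof.
have oB := edom_open (tan_ob U).
apply: (@smooth_total R (tan_ob U) (T2hat U) _ (@lambdahatf _)) => // k.
apply: Ck_row_mx => //; apply: Ck_row_mx => //; try exact: Ck_cst.
  exact: (Ck_rV_lin k _ (@lsubmx R 1 _ _)).
exact: (Ck_rV_lin k _ (@rsubmx R 1 _ _)).
Qed.
Definition lambdahat_comp U : ehom (That U) (T2hat U) := Ehom _ (@lambdahat_smooth U).

Lemma ext_tan_fun U V (f : ehom U V) :
  {in edom (tan_ob U), ext (tan_fun f) =1 tanf (ext f)}.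
Proof. by move=> x /set_mem Ux; rewrite (ext_in _ Ux). Qed.

Lemma tanf_ext_tan U V (f : ehom U V) w : edom (T2hat U) w ->
  tanf (ext (tan_fun f)) w = tanf (tanf (ext f)) w.
Proof.
move=> Uw; have Uw' : edom (tan_ob U) (lsubmx w) := Uw.
have e1 := ext_tan_fun f (mem_set Uw').
have d1 := ehom_differentiable (tan_mor f) Uw'.
have e2 : 'd (ext (tan_fun f)) (lsubmx w) (rsubmx w) =
          'd (tanf (ext f)) (lsubmx w) (rsubmx w).
  have h := diff_eq_on (edom_open (tan_ob U)) Uw' (@ext_tan_fun _ _ f) d1.
  exact: (f_equal (fun h : _ -> _ => h (rsubmx w)) h).
exact: (f_equal2 (@row_mx R 1 _ _) e1 e2).
Qed.

Lemma T2hat_morE U V (f : ehom U V) (w : T2hat U) u u0 u1 u01 :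
  ecoord w = row_mx (row_mx u u0) (row_mx u1 u01) ->
  ecoord (Fmor T2hat f w) =
    row_mx (row_mx (ext f u) ('d (ext f) u u0))
      (row_mx ('d (ext f) u u1)
              ('d (fun y => 'd (ext f) y u0) u u1 + 'd (ext f) u u01)).
Proof.
move=> E; have Uw := ecoordP w; rewrite -[LHS]/(tanf (ext (tan_fun f)) (ecoord w)).
rewrite tanf_ext_tan // E; apply: (tanf2 _ _ _ (edom_open U) (ehomP f 2)).
by move: Uw; rewrite E /= !row_mxKl.
Qed.

Lemma lambdahatP U V (f : ehom U V) :
  ecomp (lambdahat_comp V) (Fmor That f) = ecomp (Fmor T2hat f) (lambdahat_comp U).
Proof.
apply: ehom_eq => w; apply: ecoord_inj; apply: esym.
pose u := lsubmx (ecoord w); pose v := rsubmx (ecoord w).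
have E : ecoord (Fmor T2hat f (lambdahat_fun w)) = _ :=
  @T2hat_morE _ _ f (lambdahat_fun w) u 0 0 v (erefl _).
transitivity (ecoord (Fmor T2hat f (lambdahat_fun w))); first by [].
have z1 : 'd (ext f) u 0 = 0 by exact: (linear0 ('d (ext f) u)).
have z2 : 'd (fun y => 'd (ext f) y 0) u 0 = 0.
  exact: (linear0 ('d (fun y => 'd (ext f) y 0) u)).
have z3 : 'd (fun y => 'd (ext f) y 0) u 0 + 'd (ext f) u v = 'd (ext f) u v.
  by apply: etrans (add0r _); exact: (f_equal (fun t => t + _) z2).
apply: (etrans E).
transitivity (row_mx (row_mx (ext f u) (0 : 'rV[R]_(edim V))) (row_mx (0 : 'rV[R]_(edim V)) ('d (ext f) u v))).
  pose r := @row_mx R 1 (edim V) (edim V).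
  pose r' := @row_mx R 1 (edim V + edim V) (edim V + edim V).
  exact: (f_equal2 r' (f_equal (r (ext f u)) z1) (f_equal2 r z1 z3)).
transitivity (lambdahatf (tanf (ext f) (ecoord w))); last by [].
by rewrite /lambdahatf /tanf row_mxKl row_mxKr.
Qed.
Definition lambdahat : nattrans That T2hat := Nattrans lambdahatP.

Definition tauhatf n (w : 'rV[R]_((n + n) + (n + n))) : 'rV[R]_((n + n) + (n + n)) :=
  row_mx (row_mx (lsubmx (lsubmx w)) (lsubmx (rsubmx w)))
         (row_mx (rsubmx (lsubmx w)) (rsubmx (rsubmx w))).
Lemma tauhat_funP U (w : T2hat U) : edom (T2hat U) (tauhatf (ecoord w)).
Proof. by rewrite /= /tauhatf !row_mxKl; exact: (ecoordP w). Qed.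
Definition tauhat_fun U (w : T2hat U) : T2hat U := mkpt (tauhat_funP w).
Lemma tauhat_smooth U : smooth (@tauhat_fun U).
Proof.
have oB := edom_open (T2hat U).
apply: (@smooth_total R (T2hat U) (T2hat U) _ (@tauhatf _)) => // k.
pose n := edim U.
apply: Ck_row_mx => //; apply: Ck_row_mx => //.
- exact: (Ck_rV_lin k _ (@lsubmx R 1 n n \o @lsubmx R 1 (n + n) (n + n))).
- exact: (Ck_rV_lin k _ (@lsubmx R 1 n n \o @rsubmx R 1 (n + n) (n + n))).
- exact: (Ck_rV_lin k _ (@rsubmx R 1 n n \o @lsubmx R 1 (n + n) (n + n))).
- exact: (Ck_rV_lin k _ (@rsubmx R 1 n n \o @rsubmx R 1 (n + n) (n + n))).
Qed.
Definition tauhat_comp U : ehom (T2hat U) (T2hat U) := Ehom _ (@tauhat_smooth U).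
Lemma tauhatP U V (f : ehom U V) :
  ecomp (tauhat_comp V) (Fmor T2hat f) = ecomp (Fmor T2hat f) (tauhat_comp U).
Proof.
apply: ehom_eq => w; apply: ecoord_inj.
have E : ecoord w = row_mx (row_mx (lsubmx (lsubmx (ecoord w))) (rsubmx (lsubmx (ecoord w))))
    (row_mx (lsubmx (rsubmx (ecoord w))) (rsubmx (rsubmx (ecoord w)))).
  by rewrite !hsubmxK.
set u := lsubmx (lsubmx _) in E; set u0 := rsubmx (lsubmx _) in E.
set u1 := lsubmx (rsubmx _) in E; set u01 := rsubmx (rsubmx _) in E.
have E1 := @T2hat_morE _ _ f w u u0 u1 u01 E.
have E2 := @T2hat_morE _ _ f (tauhat_fun w) u u1 u0 u01 (erefl _).
apply: etrans (esym E2).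
transitivity (tauhatf (ecoord (Fmor T2hat f w))); first by [].
apply: (etrans (f_equal (@tauhatf _) E1)).
rewrite /tauhatf !row_mxKl !row_mxKr; congr (row_mx _ (row_mx _ (_ + _))).
  by rewrite row_mxKl.
by apply: (Schwarz_row _ _ (edom_open U) (ehomP f 2)); exact: (ecoordP w).
Qed.
Definition tauhat : nattrans T2hat T2hat := Nattrans tauhatP.
End TangentFunctors.

Record dflg (R : realType) := Dflg {
  dcar :> Type;
  plot : forall U : eucl R, set (U -> dcar);
  plot_cst : forall (U : eucl R) (x : dcar), plot (fun _ : U => x);
  plot_comp : forall (U V : eucl R) (f : ehom U V) (p : V -> dcar),
    plot p -> plot (p \o f);
  plot_local : forall (U : eucl R) (p : U -> dcar) (I : Type)
      (A : I -> set 'rV[R]_(edim U)) (oA : forall i, open (A i))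
      (AU : forall i, A i `<=` edom U), edom U `<=` \bigcup_i A i ->
    (forall i, plot (p \o @incl R U (A i) (oA i) (AU i))) -> plot p }.

Record dhom (R : realType) (X Y : dflg R) := Dhom {
  dfun :> X -> Y;
  dhomP : forall (U : eucl R) (p : U -> X), plot p -> plot (dfun \o p) }.

Section Dflg.
Variable R : realType.
Implicit Types (U V : eucl R) (X Y Z : dflg R).

Definition did X : dhom X X := @Dhom R X X id (fun U p pp => pp).

Definition dcomp X Y Z (g : dhom Y Z) (f : dhom X Y) : dhom X Z :=
  @Dhom R X Z (g \o f) (fun U p pp => dhomP g (dhomP f pp)).

Definition is_diso X Y (f : dhom X Y) : Prop :=
  exists g : dhom Y X, cancel f g /\ cancel g f.

Definition is_induction X Y (f : dhom X Y) : Prop :=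
  injective f /\
  forall U (p : U -> X), plot (f \o p) -> plot p.

Lemma plot_local_pt X U (p : U -> X) :
  (forall u : U, exists (A : set 'rV[R]_(edim U)) (oA : open A)
     (AU : A `<=` edom U), A (ecoord u) /\ plot (p \o @incl R U A oA AU)) ->
  plot p.
Proof.
move=> H.
pose A u := projT1 (cid (H u)).
pose oA u := projT1 (cid (projT2 (cid (H u)))).
pose AU u := projT1 (cid (projT2 (cid (projT2 (cid (H u)))))).
have HA u := projT2 (cid (projT2 (cid (projT2 (cid (H u)))))).
apply: (@plot_local R X U p U A oA AU) => [x Ux|u].
  by exists (mkpt Ux) => //; have [] := HA (mkpt Ux).
by have [] := HA u.
Qed.

Section Sub.
Variables (X : dflg R) (S : set X).
Definition dsub_plot U : set (U -> set_type S) := [set p | plot (fun u => val (p u) : X)].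
Fact dsub_cst U (x : S) : dsub_plot (fun _ : U => x).
Proof. exact: plot_cst. Qed.
Fact dsub_comp U V (f : ehom U V) (p : V -> S) : dsub_plot p -> dsub_plot (p \o f).
Proof. by move=> pp; exact: (plot_comp f pp). Qed.
Fact dsub_local U (p : U -> S) (I : Type)
    (A : I -> set 'rV[R]_(edim U)) (oA : forall i, open (A i))
    (AU : forall i, A i `<=` edom U) : edom U `<=` \bigcup_i A i ->
  (forall i, dsub_plot (p \o @incl R U (A i) (oA i) (AU i))) -> dsub_plot p.
Proof. by move=> cA pA; exact: plot_local cA pA. Qed.
Definition dsub : dflg R := Dflg dsub_cst dsub_comp dsub_local.
End Sub.

Section Power.
Variables (k : nat) (X : dflg R).
Definition dpow_plot U : set (U -> 'I_k -> X) := [set p | forall i, plot (p ^~ i)].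
Fact dpow_cst U (x : 'I_k -> X) : dpow_plot (fun _ : U => x).
Proof. by move=> i; exact: plot_cst. Qed.
Fact dpow_comp U V (f : ehom U V) (p : V -> 'I_k -> X) : dpow_plot p -> dpow_plot (p \o f).
Proof. by move=> pp i; exact: (plot_comp f (pp i)). Qed.
Fact dpow_local U (p : U -> 'I_k -> X) (I : Type)
    (A : I -> set 'rV[R]_(edim U)) (oA : forall i, open (A i))
    (AU : forall i, A i `<=` edom U) : edom U `<=` \bigcup_i A i ->
  (forall i, dpow_plot (p \o @incl R U (A i) (oA i) (AU i))) -> dpow_plot p.
Proof. by move=> cA pA j; exact: (plot_local cA (fun i => pA i j)). Qed.
Definition dpow : dflg R := Dflg dpow_cst dpow_comp dpow_local.
End Power.

(* The k-fold fibre product X x_Y .. x_Y X along f. This is only meant for k > 0: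
   for k = 0 it is a point and not Y. *)
Definition fibpow_set k X Y (f : dhom X Y) : set (dpow k X) :=
  [set x | forall i j, f (x i) = f (x j)].
Definition fibpow k X Y (f : dhom X Y) : dflg R := dsub (@fibpow_set k X Y f).

Section FibpowPair.
Variables (k : nat) (X Y Z : dflg R) (f : dhom X Y) (h : 'I_k -> dhom Z X).
Hypothesis fh : forall i j z, f (h i z) = f (h j z).
Definition fibpow_pair_fun (z : Z) : fibpow k f :=
  exist _ (fun i => h i z) (mem_set ((fun i j => fh i j z) : fibpow_set f (h ^~ z))).
Fact fibpow_pair_smooth U (p : U -> Z) : plot p -> plot (fibpow_pair_fun \o p).
Proof. by move=> pp; exact: (fun i => dhomP (h i) pp). Qed.
Definition fibpow_pair : dhom Z (fibpow k f) := Dhom fibpow_pair_smooth.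
End FibpowPair.

Section FibpowProj.
Variables (k : nat) (X Y : dflg R) (f : dhom X Y) (i : 'I_k).
Definition fibpow_proj_fun (x : fibpow k f) : X := val x i.
Fact fibpow_proj_smooth U (p : U -> fibpow k f) : plot p -> plot (fibpow_proj_fun \o p).
Proof. exact: (fun pp : forall j, plot (fun u => val (p u) j) => pp i). Qed.
Definition fibpow_proj : dhom (fibpow k f) X := Dhom fibpow_proj_smooth.
End FibpowProj.

Lemma fibpow_projE k X Y (f : dhom X Y) i j (x : fibpow k f) :
  f (fibpow_proj f i x) = f (fibpow_proj f j x).
Proof. exact: (set_mem (valP x)). Qed.

Section Yoneda.
Variable W : eucl R.
Definition yo_plot U : set (U -> W) := [set p | smooth p].
Fact yo_cst U (x : W) : yo_plot (fun _ : U => x).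
Proof. exact: smooth_cst. Qed.
Fact yo_comp U V (f : ehom U V) (p : V -> W) : yo_plot p -> yo_plot (p \o f).
Proof. by move=> pp; apply: smooth_comp => //; exact: ehomP. Qed.
Fact yo_local U (p : U -> W) (I : Type)
    (A : I -> set 'rV[R]_(edim U)) (oA : forall i, open (A i))
    (AU : forall i, A i `<=` edom U) : edom U `<=` \bigcup_i A i ->
  (forall i, yo_plot (p \o @incl R U (A i) (oA i) (AU i))) -> yo_plot p.
Proof.
move=> cA pA k; apply: Ck_local => x /cA [i _ Ax]; exists (A i); split=> //.
apply: (Ck_eq (oA i) _ (pA i k)) => y Ay.
rewrite -[y]/(ecoord (@mkpt R (Eucl (oA i)) y Ay)) extE.
by rewrite (ext_in p (AU i _ Ay)); congr (ecoord (p _)); exact: ecoord_inj.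
Qed.
Definition yo : dflg R := Dflg yo_cst yo_comp yo_local.
End Yoneda.

End Dflg.

(* Alias of the carrier that bears the D-topology. *)
Definition Dspace (R : realType) (X : dflg R) : Type := X.
Section Dtopology.
Variables (R : realType) (X : dflg R).
HB.instance Definition _ := gen_eqMixin (Dspace X).
HB.instance Definition _ := gen_choiceMixin (Dspace X).

Definition plot_preimage (U : eucl R) (p : U -> X) (S : set X) :
    set 'rV[R]_(edim U) :=
  [set x | exists2 u : U, ecoord u = x & S (p u)].

Definition Dopen (S : set (Dspace X)) : Prop :=
  forall (U : eucl R) (p : U -> X), plot p -> open (plot_preimage p S).

Fact DopenT : Dopen setT.
Proof.
move=> U p _; rewrite (_ : plot_preimage p setT = edom U); first exact: edom_open.
apply/seteqP; split=> [x [u <- _]|x Ux]; first exact: ecoordP.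
by exists (mkpt Ux).
Qed.

Fact DopenI : setI_closed Dopen.
Proof.
move=> A B oA oB U p pp.
rewrite (_ : plot_preimage p (A `&` B) = plot_preimage p A `&` plot_preimage p B).
  by apply: openI; [exact: oA|exact: oB].
apply/seteqP; split=> [x [u <- []]|x [[u <- Au] [v /ecoord_inj -> Bu]]].
  by move=> Au Bu; split; exists u.
by exists u.
Qed.

Fact Dopen_bigU (I : Type) (f : I -> set (Dspace X)) :
  (forall i, Dopen (f i)) -> Dopen (\bigcup_i f i).
Proof.
move=> of_ U p pp.
rewrite (_ : plot_preimage p (\bigcup_i f i) = \bigcup_i plot_preimage p (f i)).
  by apply: bigcup_open => i _; exact: of_.
apply/seteqP; split=> [x [u <- [i _ fu]]|x [i _ [u <- fu]]].
  by exists i => //; exists u.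
by exists u => //; exists i.
Qed.

HB.instance Definition _ := isOpenTopological.Build (Dspace X) DopenT DopenI Dopen_bigU.

Lemma open_plot_preimage (S : set (Dspace X)) (U : eucl R) (p : U -> X) :
  open S -> plot p -> open (plot_preimage p S).
Proof. by move=> oS; exact: oS. Qed.

(* Any family of sets whose preimages under plots are all open, in particular any
   topology for which the plots are continuous, consists of D-open sets. *)
Lemma Dtopology_finest (O : set (set (Dspace X))) :
  (forall S, O S -> forall (U : eucl R) (p : U -> X),
     plot p -> open (plot_preimage p S)) ->
  forall S, O S -> open S.
Proof. by move=> H S /H. Qed.

Lemma open_DspaceE : (open : set (set (Dspace X))) = Dopen.
Proof. by []. Qed.
End Dtopology.

(* The underlying set of the colimit over the category of plots [yo U -> X] of the
   spaces [yo (F U)] is the quotient of the set of triples (U, p, w), with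
   p : U -> X a plot and w in F U, by the equivalence relation generated by
   (U, q \o f, w) ~ (V, q, F f w) for smooth f : U -> V and plots q : V -> X. *)
Record kan_pre (R : realType) (F : endofunctor R) (X : dflg R) := KanPre {
  kan_dom : eucl R;
  kan_plot : kan_dom -> X;
  kan_plotP : plot kan_plot;
  kan_pt : F kan_dom }.

Arguments kan_dom {R F X}.
Arguments kan_plot {R F X}.
Arguments kan_plotP {R F X}.
Arguments kan_pt {R F X}.

Section Kan.
Variables (R : realType) (F : endofunctor R) (X : dflg R).
Implicit Types U V W : eucl R.

Definition kan_step (a b : kan_pre F X) : Prop :=
  exists2 f : ehom (kan_dom a) (kan_dom b),
    kan_plot a = kan_plot b \o f & kan_pt b = Fmor F f (kan_pt a).

HB.instance Definition _ := gen_eqMixin (kan_pre F X).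
HB.instance Definition _ := gen_choiceMixin (kan_pre F X).

Definition kan_rel : rel (kan_pre F X) :=
  fun a b => `[< clos_refl_sym_trans _ kan_step a b >].

Fact kan_rel_refl : reflexive kan_rel.
Proof. by move=> a; apply/asboolP; exact: rst_refl. Qed.
Fact kan_rel_sym : symmetric kan_rel.
Proof. by move=> a b; apply/asboolP/asboolP; exact: rst_sym. Qed.
Fact kan_rel_trans : transitive kan_rel.
Proof.
by move=> b a c /asboolP ab /asboolP bc; apply/asboolP; exact: rst_trans ab bc.
Qed.
Canonical kan_equiv := EquivRel kan_rel kan_rel_refl kan_rel_sym kan_rel_trans.

Definition kan_car : Type := {eq_quot kan_rel}.

Definition kan_in U (p : U -> X) (pp : plot p) (w : F U) : kan_car :=
  \pi_({eq_quot kan_rel}) (KanPre pp w).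

Lemma kan_inW (P : kan_car -> Prop) :
  (forall U (p : U -> X) (pp : plot p) w, P (kan_in pp w)) -> forall x, P x.
Proof. by move=> H; elim/quotW => -[U p pp w]; exact: H. Qed.

Lemma kan_in_eq U V (f : ehom U V) (p : U -> X) (q : V -> X) (pp : plot p)
    (qp : plot q) w : p = q \o f -> kan_in pp w = kan_in qp (Fmor F f w).
Proof.
move=> E; apply/eqquotP/asboolP/rst_step; by exists f.
Qed.

Section Elim.
Variables (T : Type) (g : forall U (p : U -> X), plot p -> F U -> T).
Definition kan_pre_elim (a : kan_pre F X) : T := g (kan_plotP a) (kan_pt a).
Definition kan_elim (x : kan_car) : T := kan_pre_elim (repr (x : {eq_quot kan_rel})).

Hypothesis gP : forall U V (f : ehom U V) (q : V -> X) (qp : plot q) w,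
  g (plot_comp f qp) w = g qp (Fmor F f w).

Lemma kan_elimE U (p : U -> X) (pp : plot p) w : kan_elim (kan_in pp w) = g pp w.
Proof.
rewrite /kan_elim /kan_in.
have : clos_refl_sym_trans _ kan_step (KanPre pp w)
    (repr (\pi_({eq_quot kan_rel}) (KanPre pp w))).
  have /eqquotP/asboolP : KanPre pp w = repr (\pi_({eq_quot kan_rel}) (KanPre pp w))
      %[mod {eq_quot kan_rel}] by rewrite reprK.
  by [].
have H a b : clos_refl_sym_trans _ kan_step a b -> kan_pre_elim a = kan_pre_elim b.
  elim=> {a b} [a b|a|a b _ -> //|a b c _ -> _ -> //] //.
  case: a b => [U' p' pp' w'] [V' q' qp' v'] [/= f E Ev].
  rewrite /kan_pre_elim /= Ev -gP; move: pp'; rewrite E => pp'.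
  by congr g; exact: Prop_irrelevance.
by move/H => <-.
Qed.
End Elim.

(* The colimit diffeology: plots are the maps that locally factor smoothly through
   one of the canonical maps F U -> colim. *)
Definition kan_car_plot W : set (W -> kan_car) := [set q |
  forall w : W, exists (A : set 'rV[R]_(edim W)) (oA : open A) (AW : A `<=` edom W),
    A (ecoord w) /\
    exists U (p : U -> X) (pp : plot p) (h : ehom (Eucl oA) (F U)),
      forall a, q (incl AW a) = kan_in pp (h a)].

Fact kan_cst W (x : kan_car) : kan_car_plot (fun _ : W => x).
Proof.
move=> w; exists (edom W), (edom_open W), (@subset_refl _ _); split; first exact: ecoordP.
elim/kan_inW: x => U p pp v; exists U, p, pp.
by exists (Ehom (fun _ : Eucl (edom_open W) => v) (@smooth_cst R _ _ v)).
Qed.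

Lemma ext_preimage_open U V (f : ehom U V) (A : set 'rV[R]_(edim V)) :
  open A -> open [set x | edom U x /\ A (ext f x)].
Proof.
move=> oA; rewrite openE => x [Ux Ax]; have cf := ehomP f 0 x Ux.
near=> y; split; first by near: y; exact: open_nbhs_nbhs (conj (edom_open U) Ux).
by near: y; apply: cf; exact: open_nbhs_nbhs.
Unshelve. all: by end_near. Qed.

Fact kan_comp U V (f : ehom U V) (q : V -> kan_car) :
  kan_car_plot q -> kan_car_plot (q \o f).
Proof.
move=> qp u; have [A [oA [AV [Afu [W [p [pp [h hE]]]]]]]] := qp (f u).
pose B := [set x | edom U x /\ A (ext f x)].
have oB : open B := ext_preimage_open oA.
have BU : B `<=` edom U by move=> x [].
exists B, oB, BU; split.
  by split; [exact: ecoordP|rewrite extE].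
pose g (b : Eucl oB) : Eucl oA := @mkpt R (Eucl oA) (ext f (ecoord b)) (proj2 (ecoordP b)).
have Sg : smooth g.
  apply: (@smooth_total R (Eucl oB) (Eucl oA) g (ext f)) => // k.
  exact: (Ck_sub BU (ehomP f k)).
exists W, p, pp, (ecomp h (Ehom g Sg)) => b.
rewrite /= -hE; congr q; apply: ecoord_inj.
by rewrite /= -extE.
Qed.

Fact kan_local U (p : U -> kan_car) (I : Type)
    (A : I -> set 'rV[R]_(edim U)) (oA : forall i, open (A i))
    (AU : forall i, A i `<=` edom U) : edom U `<=` \bigcup_i A i ->
  (forall i, kan_car_plot (p \o @incl R U (A i) (oA i) (AU i))) -> kan_car_plot p.
Proof.
move=> cA pA u; have [i _ Aiu] := cA _ (ecoordP u).
have [B [oB [BA [Bu [W [q [qp [h hE]]]]]]]] := pA i (@mkpt R (Eucl (oA i)) _ Aiu).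
exists B, oB, (subset_trans BA (AU i)); split; first exact: Bu.
exists W, q, qp, h => b; rewrite -hE /=; congr p; exact: ecoord_inj.
Qed.

Definition Lkan : dflg R := Dflg kan_cst kan_comp kan_local.

Fact kan_in_smooth U (p : U -> X) (pp : plot p) W (h : W -> yo (F U)) :
  plot h -> plot ((kan_in pp : F U -> Lkan) \o h).
Proof.
move=> hp w; exists (edom W), (edom_open W), (@subset_refl _ _).
split; first exact: ecoordP.
exists U, p, pp.
have Sh : smooth (fun a : Eucl (edom_open W) => h (incl (@subset_refl _ _) a) : F U).
  exact: smooth_comp hp (incl_smooth _ _).
by exists (Ehom _ Sh).
Qed.
Definition kan_inj U (p : U -> X) (pp : plot p) : dhom (yo (F U)) Lkan :=
  Dhom (kan_in_smooth pp).

(* [Lkan] with the maps [kan_inj] is a colimiting cocone in diffeological spaces: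
   [kan_inj_nat], [kan_desc], [kan_descE] and [kan_desc_unique]. *)
Lemma kan_inj_nat U V (f : ehom U V) (q : V -> X) (qp : plot q) (w : F U) :
  kan_inj (plot_comp f qp) w = kan_inj qp (Fmor F f w).
Proof. exact: kan_in_eq. Qed.

Section Desc.
Variables (Y : dflg R) (g : forall U (p : U -> X), plot p -> dhom (yo (F U)) Y).
Hypothesis gP : forall U V (f : ehom U V) (q : V -> X) (qp : plot q) w,
  g (plot_comp f qp) w = g qp (Fmor F f w).
Let g' U (p : U -> X) (pp : plot p) (w : F U) : Y := g pp w.

Fact kan_desc_smooth U (p : U -> Lkan) : plot p -> plot ((kan_elim g' : Lkan -> Y) \o p).
Proof.
move=> pp; apply: plot_local_pt => u.
have [A [oA [AU [Au [V [q [qp [h hE]]]]]]]] := pp u.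
exists A, oA, AU; split => //.
rewrite (_ : _ \o _ = g qp \o h); first exact: (dhomP (g qp) (ehomP h)).
by apply/funext => a; rewrite /= hE (kan_elimE (g := g')).
Qed.
Definition kan_desc : dhom Lkan Y := Dhom kan_desc_smooth.

Lemma kan_descE U (p : U -> X) (pp : plot p) w : kan_desc (kan_inj pp w) = g pp w.
Proof. exact: (kan_elimE (g := g')). Qed.

Lemma kan_desc_unique (h : dhom Lkan Y) :
  (forall U (p : U -> X) (pp : plot p) w, h (kan_inj pp w) = g pp w) ->
  h =1 kan_desc.
Proof. by move=> hE; apply: kan_inW => U p pp w; rewrite [RHS]kan_descE -hE. Qed.
End Desc.
End Kan.

Section KanFunctor.
Variable R : realType.
Implicit Types (U V : eucl R) (X Y Z : dflg R) (F G : endofunctor R).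

Lemma kan_in_congr F X U (p q : U -> X) (pp : plot p) (qp : plot q) (w : F U) :
  p = q -> kan_in pp w = kan_in qp w.
Proof. by move=> pq; subst q; congr kan_in; exact: Prop_irrelevance. Qed.

Definition yo_map U V (f : ehom U V) : dhom (yo U) (yo V) :=
  @Dhom R (yo U) (yo V) f (fun W p pp => smooth_comp (ehomP f) pp).

Definition plot_dhom X U (p : U -> X) (pp : plot p) : dhom (yo U) X :=
  @Dhom R (yo U) X p (fun W h hp => plot_comp (Ehom h hp) pp).

Lemma yo_id_plot U : plot (@id U : U -> yo U).
Proof. exact: smooth_id. Qed.

Section Map.
Variables (F : endofunctor R) (X Y : dflg R) (f : dhom X Y).
Let g U (p : U -> X) (pp : plot p) : dhom (yo (F U)) (Lkan F Y) :=
  kan_inj F (dhomP f pp).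
Fact Lkan_map_subproof U V (e : ehom U V) (q : V -> X) (qp : plot q) w :
  g (plot_comp e qp) w = g qp (Fmor F e w).
Proof. exact: kan_in_eq. Qed.
Definition Lkan_map : dhom (Lkan F X) (Lkan F Y) := kan_desc Lkan_map_subproof.
Lemma Lkan_mapE U (p : U -> X) (pp : plot p) w :
  Lkan_map (kan_in pp w) = kan_in (dhomP f pp) w.
Proof. exact: (kan_descE Lkan_map_subproof). Qed.
End Map.

Section Nat.
Variables (F G : endofunctor R) (a : nattrans F G) (X : dflg R).
Let g U (p : U -> X) (pp : plot p) : dhom (yo (F U)) (Lkan G X) :=
  dcomp (kan_inj G pp) (yo_map (a U)).
Fact Lnat_subproof U V (e : ehom U V) (q : V -> X) (qp : plot q) w :
  g (plot_comp e qp) w = g qp (Fmor F e w).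
Proof.
have E : a V (Fmor F e w) = Fmor G e (a U w).
  exact: (f_equal (fun h : ehom (F U) (G V) => h w) (ncompP a e)).
rewrite /g /=.
by rewrite E; exact: kan_in_eq.
Qed.
Definition Lnat : dhom (Lkan F X) (Lkan G X) := kan_desc Lnat_subproof.
Lemma LnatE U (p : U -> X) (pp : plot p) w :
  Lnat (kan_in pp w) = kan_in pp (a U w).
Proof. exact: (kan_descE Lnat_subproof). Qed.
End Nat.

Section Counit.
Variable X : dflg R.
(* The canonical isomorphism from the Kan extension of the identity functor to the
   identity functor. *)
Definition kan_unit : dhom (Lkan (functor_id R) X) X :=
  @kan_desc R (functor_id R) X X (@plot_dhom X)
    (fun U V e q qp w => erefl).
Lemma kan_unitE U (p : U -> X) (pp : plot p) (w : U) :
  kan_unit (@kan_in R (functor_id R) X U p pp w) = p w.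
Proof. exact: (@kan_descE R (functor_id R) X X (@plot_dhom X)). Qed.

Lemma kan_unit_iso : is_diso kan_unit.
Proof.
pose pt : eucl R := @Eucl R 0 setT openT.
pose o : pt := @mkpt R pt 0 I.
pose g (x : X) : Lkan (functor_id R) X :=
  @kan_in R (functor_id R) X pt _ (plot_cst pt x) o.
have gE U (p : U -> X) (pp : plot p) (u : U) :
    g (p u) = @kan_in R (functor_id R) X U p pp u.
  exact: (@kan_in_eq R (functor_id R) X pt U (Ehom (fun=> u) (@smooth_cst R _ _ u))).
have Sg U (p : U -> X) : plot p -> plot (g \o p).
  move=> pp; rewrite (_ : g \o p = kan_inj (functor_id R) pp \o @id U).
    exact: (dhomP (kan_inj (functor_id R) pp) (yo_id_plot U)).
  by apply/funext => u; exact: gE.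
exists (Dhom Sg); split=> [|x].
  by apply: kan_inW => U p pp w; rewrite kan_unitE; exact: gE.
exact: kan_unitE.
Qed.
End Counit.

Section KanYo.
Variables (F : endofunctor R) (V : eucl R).
(* The canonical isomorphism (L F) (y V) = y (F V). *)
Definition kan_yo : dhom (yo (F V)) (Lkan F (yo V)) := kan_inj F (yo_id_plot V).
Lemma kan_yo_iso : is_diso kan_yo.
Proof.
pose g U (p : U -> yo V) (pp : plot p) : dhom (yo (F U)) (yo (F V)) :=
  yo_map (Fmor F (Ehom p pp)).
have gP U W (e : ehom U W) (q : W -> yo V) (qp : plot q) w :
    g U _ (plot_comp e qp) w = g W _ qp (Fmor F e w).
  have E : Ehom _ (plot_comp e qp) = ecomp (Ehom q qp) e by exact: ehom_eq.
  transitivity (Fmor F (ecomp (Ehom q qp) e) w); last by rewrite Fmor_comp.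
  by rewrite -E.
have D := kan_descE gP.
exists (kan_desc gP); split=> [w|].
  transitivity (Fmor F (eid V) w); last by rewrite Fmor_id.
  rewrite [LHS]D; rewrite /g /=; congr (Fmor F _ w); exact: ehom_eq.
apply: kan_inW => U p pp w.
transitivity (kan_yo (g U p pp w)); first by congr (kan_yo _); exact: D.
by apply: esym; exact: (kan_in_eq (f := Ehom p pp)).
Qed.
End KanYo.

(* On the summand of a plot p : U -> X, [mu] is the composite
   y F G U -> (L F) (y G U) -> (L F) (L G) X of [kan_yo] and of (L F) applied to the
   canonical map y G U -> (L G) X. *)
Section Mu.
Variables (F G : endofunctor R) (X : dflg R).
Let g U (p : U -> X) (pp : plot p) : dhom (yo (F (G U))) (Lkan F (Lkan G X)) :=
  dcomp (Lkan_map F (kan_inj G pp)) (kan_yo F (G U)).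
Fact kan_in_plot U (p : U -> X) (pp : plot p) :
  plot (kan_in pp : G U -> Lkan G X).
Proof. exact: (dhomP (kan_inj G pp) (yo_id_plot (G U))). Qed.
Let gE U (p : U -> X) (pp : plot p) w : g pp w = kan_in (kan_in_plot pp) w.
Proof.
apply: (etrans (@Lkan_mapE F _ _ (kan_inj G pp) _ _ (yo_id_plot (G U)) w)).
exact: kan_in_congr.
Qed.
Fact mu_subproof U V (e : ehom U V) (q : V -> X) (qp : plot q) w :
  g (plot_comp e qp) w = g qp (Fmor (functor_comp F G) e w).
Proof.
rewrite !gE; apply: (kan_in_eq (f := Fmor G e)).
by apply/funext => v; exact: kan_in_eq.
Qed.
Definition mu : dhom (Lkan (functor_comp F G) X) (Lkan F (Lkan G X)) :=
  @kan_desc R (functor_comp F G) X _ g mu_subproof.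
Lemma muE U (p : U -> X) (pp : plot p) (w : F (G U)) :
  mu (@kan_in R (functor_comp F G) X U p pp w) = kan_in (kan_in_plot pp) w.
Proof. by rewrite -gE; exact: (@kan_descE R (functor_comp F G) X _ g mu_subproof). Qed.
End Mu.
End KanFunctor.

Section Tangent.
Variable R : realType.
Implicit Types X Y : dflg R.

Definition Tan X : dflg R := Lkan (That R) X.
Definition Tmap X Y (f : dhom X Y) : dhom (Tan X) (Tan Y) := Lkan_map (That R) f.
Definition Tpi X : dhom (Tan X) X := dcomp (kan_unit X) (Lnat (pihat R) X).
Definition Tk (k : nat) X : dflg R := fibpow k (Tpi X).

Lemma TpiE X (U : eucl R) (p : U -> X) (pp : plot p) (w : That R U) :
  Tpi X (kan_in pp w) = p (pihat R U w).
Proof.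
transitivity (kan_unit X (@kan_in R (functor_id R) X U p pp (pihat R U w))).
  by congr (kan_unit X _); exact: LnatE.
exact: kan_unitE.
Qed.

Section Theta.
Variables (k : nat) (X : dflg R).
Fact theta_subproof (i j : 'I_k) (z : Lkan (Tkhat R k) X) :
  Tpi X (Lnat (prhat R i) X z) = Tpi X (Lnat (prhat R j) X z).
Proof.
elim/kan_inW: z => U p pp w; rewrite !LnatE !TpiE; congr p.
apply: ecoord_inj.
transitivity (lsubmx (prhatf i (ecoord w))); first by [].
transitivity (lsubmx (prhatf j (ecoord w))); last by [].
by rewrite /prhatf !row_mxKl.
Qed.
Definition theta : dhom (Lkan (Tkhat R k) X) (Tk k X) := fibpow_pair theta_subproof.
End Theta.

Definition theta2 X : dhom (Lkan (T2hat R) X) (Tan (Tan X)) := mu (That R) (That R) X.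

Definition lambda X : dhom (Tan X) (Tan (Tan X)) :=
  dcomp (theta2 X) (Lnat (lambdahat R) X).

Section Nu.
Variables (k : nat) (X : dflg R).
Fact nu_subproof (i j : 'I_k) (z : Tan (Tk k X)) :
  Tmap (Tpi X) (Tmap (fibpow_proj (Tpi X) i) z) =
  Tmap (Tpi X) (Tmap (fibpow_proj (Tpi X) j) z).
Proof.
elim/kan_inW: z => U p pp w; rewrite /Tmap !Lkan_mapE.
by apply: kan_in_congr; apply/funext => u; exact: fibpow_projE.
Qed.
Definition nu : dhom (Tan (Tk k X)) (fibpow k (Tmap (Tpi X))) :=
  fibpow_pair nu_subproof.
End Nu.

Definition elastic1 X : Prop := forall k : nat, (1 < k)%N -> is_diso (theta k X).

Definition elastic2 X : Prop := exists tau : dhom (Tan (Tan X)) (Tan (Tan X)),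
  forall x, tau (theta2 X x) = theta2 X (Lnat (tauhat R) X x).

Definition elastic3 X : Prop := is_induction (lambda X).

Definition elastic4 X : Prop := forall k : nat, (1 < k)%N -> injective (nu k X).

Definition iterTk (ks : seq nat) X : dflg R := foldr Tk X ks.

Definition elastic X : Prop :=
  [/\ elastic1 X, elastic2 X, elastic3 X, elastic4 X &
    forall ks : seq nat, all (leq 1) ks ->
      [/\ elastic1 (iterTk ks X), elastic2 (iterTk ks X),
          elastic3 (iterTk ks X) & elastic4 (iterTk ks X)]].

Definition is_open_cover X (I : Type) (S : I -> set X) : Prop :=
  (forall i, open (S i : set (Dspace X))) /\ \bigcup_i S i = setT.

End Tangent.

(* Main.v *)
From mathcomp Require Import all_boot all_order all_algebra.
From mathcomp Require Import all_classical all_reals topology normedtype derive.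
Require Import Defs.

Set Implicit Arguments. Unset Strict Implicit. Unset Printing Implicit Defensive.
Import numFieldNormedType.Exports.
Local Open Scope classical_set_scope.
Local Open Scope ring_scope.

(** Elasticity is a local property because every construction that enters its
axioms is compatible with restriction to open subsets.

An open embedding is an induction with open image, and an open covering is a
jointly surjective family of open embeddings [j i : Y i -> X].  Working with maps
instead of subsets makes the construction iterable: applying [Tk k], [k > 0], to an
open covering of [X] gives an open covering of [Tk k X], hence of every iterated
space [iterTk ks X] ([open_covering_iterTk]).  It also makes both directions of the
theorem instances of a single lemma ([elastic_local]): the inclusions of the members
of an open cover form an open covering of [X], while the identity of [X] is a
one-member open covering of the total subspace of [X].

The link with Kan extensions is the notion of a local endofunctor [F] of Euclidean
domains: there is a natural base map [F U -> U], and for [A] open in [U] the space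
[F A] is the part of [F U] over [A].  Tangent functors are local because the
derivative of an inclusion is the identity, and local functors compose.  If [F] is
local then [Lkan F] sends an open embedding [j] to an open embedding, whose image
consists of the points based in the image of [j] ([open_embedding_Lkan_map],
[range_Lkan_map]).

It remains to see that each axiom can be tested on an open covering.  The first and
the third say that natural maps are inductions (and surjective, for the first), and
the fourth that natural maps are injective; as all these maps preserve base points,
such properties are local.  The second asks for the existence of a morphism, and local
morphisms need not glue a priori.  However [theta2] is a subduction ([mu_lift]), so
that the morphism is unique and exists as soon as the kernel pair of [theta2] is
respected ([elastic2P]), a condition on points that is local again. *)

(** * Open embeddings *)

Section OpenEmbedding.
Variable R : realType.
Implicit Types (U V W : eucl R) (X Y Z : dflg R).

Lemma plot_preimage_sub X U (p : U -> X) (S : set X) :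
  plot_preimage p S `<=` edom U.
Proof. by move=> _ [u <- _]; exact: ecoordP. Qed.

Lemma open_dhom_preimage X Y (f : dhom X Y) (S : set Y) :
  open (S : set (Dspace Y)) -> open (f @^-1` S : set (Dspace X)).
Proof.
move=> oS; change (Dopen (f @^-1` S : set (Dspace X))) => U p pp.
exact: (open_plot_preimage oS (dhomP f pp)).
Qed.

Definition open_embedding X Y (f : dhom X Y) : Prop :=
  is_induction f /\ open (range f : set (Dspace Y)).

(** A plot lifts to an induction over the open part of its domain that lands in the
image: any pointwise lift is automatically a plot. *)
Lemma induction_lift X Y (f : dhom Y X) U (p : U -> X)
    (oA : open (plot_preimage p (range f))) : is_induction f -> plot p ->
  exists q : Eucl oA -> Y, plot q /\
    forall a, f (q a) = p (eincl oA (@plot_preimage_sub X U p (range f)) a).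
Proof.
move=> [_ indf] pp.
have H (a : Eucl oA) : exists y, f y = p (eincl oA (@plot_preimage_sub X U p (range f)) a).
  have [u ua [y _ fy]] := ecoordP a; exists y; rewrite fy; congr p.
  exact: ecoord_inj.
have [q qE] := choice H.
exists q; split => //; apply: indf.
rewrite (_ : f \o q = p \o eincl oA (@plot_preimage_sub X U p (range f))).
  exact: plot_comp.
by apply/funext => a; exact: qE.
Qed.

(** Isomorphisms reflect plots, and a bijection that reflects plots has a smooth
inverse.  In this form being an isomorphism is visibly a local property. *)
Lemma diso_inductionP X Y (f : dhom X Y) :
  is_diso f <-> is_induction f /\ forall y, range f y.
Proof.
split=> [[g [fK gK]]|[[injf indf] surjf]].
  split; last by move=> y; exists (g y).
  split=> [|U p fpp]; first exact: can_inj fK.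
  rewrite (_ : p = g \o (f \o p)); first exact: dhomP.
  by apply/funext => u /=; rewrite fK.
have /choice[g gK] : forall y, exists x, f x = y.
  by move=> y; have [x _ <-] := surjf y; exists x.
have Sg U (p : U -> Y) : plot p -> plot (g \o p).
  by move=> pp; apply: indf; rewrite (_ : _ \o _ = p) //; apply/funext => u /=; exact: gK.
by exists (Dhom Sg); split=> // x; apply: injf; rewrite gK.
Qed.

(** The members [Y i] are arbitrary spaces, not subspaces of [X], so that functors can
be applied to a covering. *)
Definition open_covering (I : Type) X (Y : I -> dflg R)
    (j : forall i, dhom (Y i) X) : Prop :=
  (forall i, open_embedding (j i)) /\ forall x, exists i, range (j i) x.

(** Inductions can be recognized on an open covering [b] of the target.  The third
hypothesis says that the squares formed by [f' i] and [f] are weak pullbacks.  It makes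
two points with the same image under [f] lift to the same member [A' i], and it lifts a
map into [A] wherever its composite with [f] lifts to [B' i]. *)
Lemma induction_local (I : Type) (A B : dflg R) (f : dhom A B) (A' B' : I -> dflg R)
    (f' : forall i, dhom (A' i) (B' i)) (a : forall i, dhom (A' i) A)
    (b : forall i, dhom (B' i) B) :
  open_covering b ->
  (forall i x, f (a i x) = b i (f' i x)) ->
  (forall i z, range (b i) (f z) -> range (a i) z) ->
  (forall i, is_induction (f' i)) -> is_induction f.
Proof.
move=> [emb cov] sq lft ind; split=> [z z' fzz'|U p fpp].
  have [i fz] := cov (f z).
  have [y _ yz] := lft i z fz.
  have [y' _ yz'] : range (a i) z' by apply: lft; rewrite -fzz'.
  rewrite -yz -yz'; congr (a i _); apply: (ind i).1.
  by apply: (emb i).1.1; rewrite -!sq yz yz'.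
apply: plot_local_pt => u; have [i fpu] := cov (f (p u)).
have oA := open_plot_preimage (emb i).2 fpp.
exists _, oA, (@plot_preimage_sub B U (f \o p) _); split; first by exists u.
have [q [qp qE]] := induction_lift oA (emb i).1 fpp.
have /choice[r rE] : forall x, exists y, a i y = p (eincl oA (@plot_preimage_sub B U (f \o p) _) x).
  move=> x; have [|y _ <-] := lft i (p (eincl oA (@plot_preimage_sub B U (f \o p) _) x)).
    by exists (q x) => //; exact: qE.
  by exists y.
rewrite (_ : _ \o _ = a i \o r); last by apply/funext => x; rewrite /= rE.
apply: dhomP; apply: (ind i).2; rewrite (_ : _ \o _ = q) //.
by apply/funext => x; apply: (emb i).1.1; rewrite -sq rE qE.
Qed.
End OpenEmbedding.

(** * Local endofunctors *)

Section LocalFunctor.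
Variable R : realType.
Implicit Types (U V W : eucl R) (F G : endofunctor R).

Lemma ehom_corestrict U W (A : set 'rV[R]_(edim U)) (oA : open A)
    (AU : A `<=` edom U) (h : ehom W U) : (forall w, A (ecoord (h w))) ->
  exists h' : ehom W (Eucl oA), forall w, eincl oA AU (h' w) = h w.
Proof.
move=> Ah; pose h' w : Eucl oA := @mkpt R (Eucl oA) _ (Ah w).
have Sh' : smooth h'.
  apply: (@smooth_total R W (Eucl oA) h' (ext h)) => [w|k]; last exact: ehomP.
  by rewrite extE.
by exists (Ehom h' Sh') => w; apply: ecoord_inj.
Qed.

(** Locality says that [F A] is the subspace of [F U] over [A], for [A] open in [U],
expressed by the universal property of an open subset: [F] of the inclusion is
injective, and smooth maps into [F U] with base points in [A] lift along it. *)
Definition local_functor F (b : nattrans F (functor_id R)) : Prop :=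
  forall U (A : set 'rV[R]_(edim U)) (oA : open A) (AU : A `<=` edom U),
    injective (Fmor F (eincl oA AU)) /\
    forall W (h : ehom W (F U)), (forall w, A (ecoord (b U (h w) : U))) ->
      exists h' : ehom W (F (Eucl oA)), forall w, Fmor F (eincl oA AU) (h' w) = h w.

Section CompBase.
Variables (F G : endofunctor R).
Variables (b : nattrans F (functor_id R)) (c : nattrans G (functor_id R)).
Definition comp_base_fun U : ehom (functor_comp F G U) (functor_id R U) :=
  ecomp (c U : ehom (G U) U) (b (G U) : ehom (F (G U)) (G U)).
Fact comp_baseP U V (f : ehom U V) :
  ecomp (comp_base_fun V) (Fmor (functor_comp F G) f) =
  ecomp (Fmor (functor_id R) f) (comp_base_fun U).
Proof.
apply: ehom_eq => w.
have E1 := f_equal (fun h : ehom _ _ => h w) (ncompP b (Fmor G f)).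
have E2 := f_equal (fun h : ehom _ _ => h (b (G U) w)) (ncompP c f).
exact: etrans (f_equal (c V) E1) E2.
Qed.
Definition comp_base : nattrans (functor_comp F G) (functor_id R) :=
  Nattrans comp_baseP.

(** [F (G A)] is the part of [F (G U)] over [A] because [G A] is isomorphic to an open
subset [B] of [G U], on which the locality of [F] can be used. *)
Lemma local_functor_comp : local_functor b -> local_functor c ->
  local_functor comp_base.
Proof.
move=> lb lc U A oA AU; have [injA liftA] := lc U A oA AU.
pose B := [set x : 'rV[R]_(edim (G U)) | edom (G U) x /\ A (ext (c U) x)].
have oB : open B := @ext_preimage_open R _ _ (c U) A oA.
have BG : B `<=` edom (G U) by move=> x [].
have [injB liftB] := lb (G U) B oB BG.
have cincl (x : Eucl oB) : A (ecoord (c U (eincl oB BG x) : U)).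
  rewrite -(extE (c U) (eincl oB BG x)); exact: (proj2 (ecoordP x)).
(* [s : B -> G A] and [t : G A -> B] identify [G A] with [B] over [G U]. *)
have [s sE] := liftA _ (eincl oB BG) cincl.
have Bincl (x : G (Eucl oA)) : B (ecoord (Fmor G (eincl oA AU) x)).
  split; first exact: ecoordP.
  rewrite extE.
  rewrite (f_equal (fun h : ehom _ _ => h x) (ncompP c (eincl oA AU)) :
    c U (Fmor G (eincl oA AU) x) = eincl oA AU (c (Eucl oA) x)).
  exact: (ecoordP (c (Eucl oA) x : Eucl oA)).
have [t tE] := ehom_corestrict oB BG Bincl.
have st : ecomp s t = eid _.
  by apply: ehom_eq => x; apply: injA; rewrite /= sE tE.
have it : ecomp (eincl oB BG) t = Fmor G (eincl oA AU) by exact: ehom_eq.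
have is' : ecomp (Fmor G (eincl oA AU)) s = eincl oB BG by exact: ehom_eq.
split=> [x y xy|W h Ah].
  have {}xy : Fmor F (Fmor G (eincl oA AU)) x = Fmor F (Fmor G (eincl oA AU)) y := xy.
  have {}xy : Fmor F t x = Fmor F t y.
    by apply: injB; move: xy; rewrite -it Fmor_comp.
  have E z : z = Fmor F s (Fmor F t z).
    transitivity (Fmor F (ecomp s t) z); last by rewrite Fmor_comp.
    by rewrite st Fmor_id.
  by rewrite (E x) (E y) xy.
have [|h1 h1E] := liftB W h.
  move=> w; split; first exact: (ecoordP (b (G U) (h w) : G U)).
  by rewrite extE; exact: Ah.
exists (ecomp (Fmor F s) h1) => w; rewrite -h1E.
change (Fmor F (Fmor G (eincl oA AU)) (Fmor F s (h1 w)) =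
  Fmor F (eincl oB BG) (h1 w)).
by rewrite -is' Fmor_comp.
Qed.
End CompBase.

Definition tank_base_fun k U (w : Tkhat R k U) : U :=
  @mkpt R U (lsubmx (ecoord w)) (ecoordP w).
Fact tank_base_smooth k U : smooth (@tank_base_fun k U).
Proof.
apply: (@smooth_total R (tank_ob k U) U _ lsubmx) => // l.
exact: (Ck_rV_lin l _ (@lsubmx R 1 _ _)).
Qed.
Definition tank_base_comp k U : ehom (Tkhat R k U) (functor_id R U) :=
  Ehom _ (@tank_base_smooth k U).
Fact tank_baseP k U V (f : ehom U V) :
  ecomp (tank_base_comp k V) (Fmor (Tkhat R k) f) =
  ecomp (Fmor (functor_id R) f) (tank_base_comp k U).
Proof.
apply: ehom_eq => w; apply: ecoord_inj.
change (lsubmx (tankf (ext f) (ecoord w)) = ecoord (f (tank_base_fun w))).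
by rewrite /tankf row_mxKl -extE.
Qed.
Definition tank_base k : nattrans (Tkhat R k) (functor_id R) := Nattrans (@tank_baseP k).

Lemma ext_eincl U (A : set 'rV[R]_(edim U)) (oA : open A) (AU : A `<=` edom U) :
  {in A, ext (eincl oA AU) =1 id}.
Proof. by move=> x /set_mem Ax; rewrite (@ext_in R (Eucl oA) U _ x Ax). Qed.

(** The extension by zero of an inclusion is not the identity, but it agrees with the
identity near every point of the open subset. *)
Lemma diff_eincl U (A : set 'rV[R]_(edim U)) (oA : open A) (AU : A `<=` edom U) x v :
  A x -> 'd (ext (eincl oA AU)) x v = v.
Proof.
move=> Ax.
transitivity ('d (@id 'rV[R]_(edim U)) x v).
  exact: (f_equal (fun h : _ -> _ => h v)
     (diff_eq_on oA Ax (ext_eincl oA AU) (ehom_differentiable (eincl oA AU) Ax))).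
exact: (f_equal (fun h : _ -> _ => h v) (@diff_val _ _ _ _ _ _ _ (is_diff_id x))).
Qed.

Lemma ecoord_tan_eincl U (A : set 'rV[R]_(edim U)) (oA : open A)
    (AU : A `<=` edom U) (w : That R (Eucl oA)) :
  ecoord (Fmor (That R) (eincl oA AU) w) = ecoord w.
Proof.
have Aw : A (lsubmx (ecoord w)) := ecoordP w.
change (tanf (ext (eincl oA AU)) (ecoord w) = ecoord w).
by rewrite /tanf (ext_eincl oA AU (mem_set Aw)) diff_eincl // hsubmxK.
Qed.

Lemma ecoord_tank_eincl k U (A : set 'rV[R]_(edim U)) (oA : open A)
    (AU : A `<=` edom U) (w : Tkhat R k (Eucl oA)) :
  ecoord (Fmor (Tkhat R k) (eincl oA AU) w) = ecoord w.
Proof.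
have Aw : A (lsubmx (ecoord w)) := ecoordP w.
change (tankf (ext (eincl oA AU)) (ecoord w) = ecoord w).
rewrite /tankf (ext_eincl oA AU (mem_set Aw)) -[RHS]hsubmxK; congr row_mx.
rewrite -[RHS]vec_mxK; congr mxvec; apply/row_matrixP => i.
by rewrite rowK diff_eincl.
Qed.


Lemma local_That : local_functor (pihat R).
Proof.
move=> U A oA AU; split=> [x y xy|W h Ah].
  apply: ecoord_inj; rewrite -!(ecoord_tan_eincl AU).
  exact: (f_equal (@ecoord R _) xy).
have BU : edom (That R (Eucl oA)) `<=` edom (That R U) by move=> x /AU.
have [h' h'E] := @ehom_corestrict (That R U) W _ (edom_open (That R (Eucl oA))) BU h Ah.
exists h' => w; apply: ecoord_inj; rewrite ecoord_tan_eincl -h'E; exact: erefl.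
Qed.

Lemma local_Tkhat k : local_functor (tank_base k).
Proof.
move=> U A oA AU; split=> [x y xy|W h Ah].
  apply: ecoord_inj; rewrite -!(ecoord_tank_eincl AU).
  exact: (f_equal (@ecoord R _) xy).
have BU : edom (Tkhat R k (Eucl oA)) `<=` edom (Tkhat R k U) by move=> x /AU.
have [h' h'E] := @ehom_corestrict (Tkhat R k U) W _ (edom_open (Tkhat R k (Eucl oA))) BU h Ah.
exists h' => w; apply: ecoord_inj; rewrite ecoord_tank_eincl -h'E; exact: erefl.
Qed.

End LocalFunctor.

(** * Kan extensions of local endofunctors *)

Section KanLocal.
Variable R : realType.
Implicit Types (U V W : eucl R) (X Y Z : dflg R) (F G : endofunctor R).

Lemma ncompE F G (a : nattrans F G) U V (f : ehom U V) (w : F U) :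
  a V (Fmor F f w) = Fmor G f (a U w).
Proof. exact: (f_equal (fun h : ehom _ _ => h w) (ncompP a f)). Qed.

(** The base point of an element of the Kan extension; for [pihat] this is [Tpi]. *)
Definition Lbase F (b : nattrans F (functor_id R)) X : dhom (Lkan F X) X :=
  dcomp (kan_unit X) (Lnat b X).

Lemma LbaseE F (b : nattrans F (functor_id R)) X U (p : U -> X) (pp : plot p) w :
  Lbase b X (kan_in pp w) = p (b U w).
Proof.
apply: etrans (kan_unitE pp (b U w)).
by congr (kan_unit X _); exact: LnatE.
Qed.

Lemma Lkan_map_Lbase F (b : nattrans F (functor_id R)) X Y (f : dhom X Y) z :
  Lbase b Y (Lkan_map F f z) = f (Lbase b X z).
Proof. by elim/kan_inW: z => U p pp w; rewrite Lkan_mapE !LbaseE. Qed.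

Lemma Lkan_map_Lnat F G (a : nattrans F G) X Y (f : dhom X Y) z :
  Lnat a Y (Lkan_map F f z) = Lkan_map G f (Lnat a X z).
Proof. by elim/kan_inW: z => U p pp w; rewrite Lkan_mapE !LnatE Lkan_mapE. Qed.

Lemma Lkan_map_mu F G X Y (f : dhom X Y) z :
  mu F G Y (Lkan_map (functor_comp F G) f z) =
  Lkan_map F (Lkan_map G f) (mu F G X z).
Proof.
elim/kan_inW: z => U p pp w.
rewrite (@Lkan_mapE _ (functor_comp F G)).
apply: (etrans (muE _ _)); rewrite (@muE R F G X U p pp w) Lkan_mapE.
by apply: kan_in_congr; apply/funext => v /=; rewrite -[RHS]/(Lkan_map G f _) Lkan_mapE.
Qed.

Lemma Lkan_map_comp F X Y Z (f : dhom X Y) (g : dhom Y Z) (h : dhom X Z) z :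
  (forall x, g (f x) = h x) -> Lkan_map F g (Lkan_map F f z) = Lkan_map F h z.
Proof.
move=> gfh; elim/kan_inW: z => U p pp w; rewrite !Lkan_mapE.
by apply: kan_in_congr; apply/funext => v /=; exact: gfh.
Qed.

Section Embedding.
Variables (F : endofunctor R) (b : nattrans F (functor_id R)).
Hypothesis lb : local_functor b.
Variables (X Y : dflg R) (j : dhom Y X).
Hypothesis embj : open_embedding j.

Let dom_of U (p : U -> X) := plot_preimage p (range j).
Let dom_sub U (p : U -> X) : dom_of p `<=` edom U :=
  @plot_preimage_sub R X U p (range j).
Let dom_open U (p : U -> X) : plot p -> open (dom_of p).
Proof. exact: (open_plot_preimage embj.2). Qed.

(** A smooth family in one summand [F U] of the colimit that is based in the image of
[j] comes from [Y]: shrink [U] to the preimage of that image, using locality of [F]. *)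
Lemma Lkan_lift U (p : U -> X) (pp : plot p) W (h : ehom W (F U)) :
  (forall w, range j (p (b U (h w)))) ->
  exists V (q : V -> Y) (qp : plot q) (h' : ehom W (F V)),
    forall w, Lkan_map F j (kan_in qp (h' w)) = kan_in pp (h w).
Proof.
move=> jh; have oA := dom_open pp.
have [q [qp qE]] := induction_lift oA embj.1 pp.
have [_ liftA] := lb oA (@dom_sub U p).
have [|h' h'E] := liftA W h; first by move=> w; exists (b U (h w)).
exists (Eucl oA), q, qp, h' => w; rewrite Lkan_mapE -h'E.
by apply: (kan_in_eq (f := eincl oA (@dom_sub U p))); apply/funext => a; exact: qE.
Qed.

(** A partial inverse of [Lkan_map F j], defined on the points based in the image of [j]
by restricting a plot to the open set where it lifts to [Y].  It is encoded by
set-valued functions, as being empty elsewhere avoids any default value and makes its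
naturality a plain equality of sets. *)
Let retract U (p : U -> X) (pp : plot p) (w : F U) : set (Lkan F Y) :=
  [set y | exists (oA : open (dom_of p)) (q : Eucl oA -> Y) (qp : plot q)
     (w' : F (Eucl oA)),
     [/\ forall a, j (q a) = p (eincl oA (@dom_sub U p) a),
         Fmor F (eincl oA (@dom_sub U p)) w' = w & y = kan_in qp w']].

Let retract_nat U V (f : ehom U V) (q : V -> X) (qp : plot q) w :
  retract (plot_comp f qp) w = retract qp (Fmor F f w).
Proof.
have oA := dom_open (plot_comp f qp); have oB := dom_open qp.
pose iA := eincl oA (@dom_sub U (q \o f)); pose iB := eincl oB (@dom_sub V q).
have [|fr frE] := @ehom_corestrict R V _ _ oB (@dom_sub V q) (ecomp f iA).
  by move=> a; have [u ua jqu] := ecoordP a; exists (f (iA a)) => //;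
     rewrite (_ : iA a = u) //; exact: ecoord_inj.
have FfrE : ecomp (Fmor F iB) (Fmor F fr) = ecomp (Fmor F f) (Fmor F iA).
  by rewrite -!Fmor_comp; congr (Fmor F _); exact: ehom_eq.
have {}FfrE x : Fmor F iB (Fmor F fr x) = Fmor F f (Fmor F iA x).
  exact: (f_equal (fun h : ehom _ _ => h x) FfrE).
have [injB _] := lb oB (@dom_sub V q); have [_ liftA] := lb oA (@dom_sub U (q \o f)).
have [rB [rBp rBE]] := induction_lift oB embj.1 qp.
have rP (r : Eucl oA -> Y) : (forall a, j (r a) = q (f (iA a))) -> r = rB \o fr.
  move=> rE; apply/funext => a; apply: embj.1.1.
  by rewrite rE /= rBE frE.
apply/seteqP; split=> y.
  move=> [oA' [r [rp [w' [rE wE ->]]]]].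
  have EoA : oA' = oA by exact: Prop_irrelevance.
  subst oA'; exists oB, rB, rBp, (Fmor F fr w'); split=> //.
    by rewrite -wE; exact: FfrE.
  by apply: kan_in_eq; exact: rP.
move=> [oB' [r [rp [w' [rE wE ->]]]]].
have EoB : oB' = oB by exact: Prop_irrelevance.
subst oB'.
have [|h hE] := liftA (F U) (Ehom (fun=> w) (@smooth_cst R _ _ w)).
  move=> _ /=; exists (b U w) => //; exists (r (b _ w')) => //.
  rewrite rE; congr q.
  transitivity (b V (Fmor F iB w')); first exact: (esym (ncompE b iB w')).
  by rewrite wE; exact: (ncompE b f w).
have {}hE : Fmor F iA (h w) = w := hE w.
exists oA, (rB \o fr), (plot_comp fr rBp), (h w); split=> //.
  by move=> a; rewrite /= rBE frE.
rewrite (_ : w' = Fmor F fr (h w)); last by apply: injB; rewrite FfrE hE.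
apply: esym; apply: kan_in_eq; apply/funext => a /=; apply: embj.1.1.
by rewrite rE rBE.
Qed.

Let retractE z : kan_elim retract (Lkan_map F j z) = [set z].
Proof.
elim/kan_inW: z => U p pp w; rewrite Lkan_mapE (kan_elimE retract_nat).
have jp := dhomP j pp; have oA := dom_open jp.
apply/seteqP; split=> y.
  move=> [oA' [q [qp [w' [qE wE ->]]]]]; rewrite -wE /=.
  by apply: kan_in_eq; apply/funext => a; apply: embj.1.1; exact: qE.
move=> ->; have [q [qp qE]] := induction_lift oA embj.1 jp.
have [_ liftA] := lb oA (@dom_sub U (j \o p)).
have [|h hE] := liftA (F U) (Ehom (fun=> w) (@smooth_cst R _ _ w)).
  by move=> _ /=; exists (b U w) => //; exists (p (b U w)).
have {}hE : Fmor F (eincl oA (@dom_sub U (j \o p))) (h w) = w := hE w.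
exists oA, q, qp, (h w); split; [exact: qE|exact: hE|].
rewrite -[w in LHS]hE; apply: esym.
apply: (kan_in_eq (f := eincl oA (@dom_sub U (j \o p)))).
by apply/funext => a; apply: embj.1.1; exact: qE.
Qed.

Lemma range_Lkan_map z : range (Lkan_map F j) z <-> range j (Lbase b X z).
Proof.
split=> [[y _ <-]|]; first by rewrite Lkan_map_Lbase; exists (Lbase b Y y).
elim/kan_inW: z => U p pp w; rewrite LbaseE => jw.
have [V [q [qp [h hE]]]] :=
  @Lkan_lift U p pp (F U) (Ehom (fun=> w) (@smooth_cst R _ _ w)) (fun=> jw).
by exists (kan_in qp (h w)) => //; exact: hE.
Qed.

(** Injectivity holds because [retract] recovers a point from its image; plots are
reflected because they are, locally, smooth families in one summand, to which
[Lkan_lift] applies. *)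
Lemma open_embedding_Lkan_map : open_embedding (Lkan_map F j).
Proof.
have injL : injective (Lkan_map F j).
  move=> z z' zz'; have : [set z] z' by rewrite -retractE zz' retractE.
  by move=> /esym.
split; last first.
  rewrite (_ : range _ = Lbase b X @^-1` range j).
    exact: open_dhom_preimage embj.2.
  by apply/seteqP; split=> z /range_Lkan_map.
split=> // W P LP; apply: plot_local_pt => w.
have [A [oA [AW [Aw [U [p [pp [h hE]]]]]]]] := LP w.
have [|V [q [qp [h' h'E]]]] := @Lkan_lift U p pp _ h.
  move=> a; have := Lkan_map_Lbase b j (P (incl AW a)).
  rewrite -[Lkan_map F j _]/((Lkan_map F j \o P) (incl AW a)) hE LbaseE => ->.
  by eexists.
exists A, oA, AW; split=> //.
rewrite (_ : _ \o _ = kan_inj F qp \o h').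
  exact: (dhomP (kan_inj F qp) (ehomP h')).
apply/funext => a; apply: injL; rewrite /= -[RHS]/(Lkan_map F j (kan_in qp (h' a))).
by rewrite h'E -hE.
Qed.
End Embedding.

(** [mu] is a subduction.  A plot of the iterated extension is locally a smooth family
[h] in one summand [F V] for a plot [q : V -> Lkan G X], and near the base point [q]
itself factors through one summand [G U].  Locality of [F] moves [h] to the
neighbourhood where [q] factors. *)
Lemma mu_lift F (b : nattrans F (functor_id R)) (lb : local_functor b) G X W
    (P : W -> Lkan F (Lkan G X)) : plot P -> forall w : W,
  exists (A : set 'rV[R]_(edim W)) (oA : open A) (AW : A `<=` edom W),
    A (ecoord w) /\
    exists Q : Eucl oA -> Lkan (functor_comp F G) X, plot Q /\
      forall a, mu F G X (Q a) = P (eincl oA AW a).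
Proof.
move=> PP w; have [A [oA [AW [Aw [V [q [qp [h hE]]]]]]]] := PP w.
pose w0 : Eucl oA := @mkpt R (Eucl oA) _ Aw.
have [B [oB [BV [Bw [U [p [pp [g gE]]]]]]]] := qp (b V (h w0)).
pose bh : ehom (Eucl oA) V := ecomp (b V : ehom (F V) V) h.
pose C := [set x : 'rV[R]_(edim W) | edom (Eucl oA) x /\ B (ext bh x)].
have oC : open C := @ext_preimage_open R _ _ bh B oB.
have CA : C `<=` edom (Eucl oA) by move=> x [].
have CW : C `<=` edom W by move=> x /CA /AW.
exists C, oC, CW; split.
  split; first exact: Aw.
  by rewrite (@extE R (Eucl oA) V bh w0).
have [_ liftB] := lb V B oB BV.
pose iC := @eincl R (Eucl oA) C oC CA.
have [|h' h'E] := liftB _ (ecomp h iC).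
  move=> c; have [Ac Bc] := ecoordP c; move: Bc.
  by rewrite -[ecoord c]/(ecoord (iC c)) extE.
exists (fun c => @kan_in R (functor_comp F G) X U p pp (Fmor F g (h' c))); split.
  exact: (dhomP (@kan_inj R (functor_comp F G) X U p pp) (ehomP (ecomp (Fmor F g) h'))).
move=> c; apply: etrans (muE pp (Fmor F g (h' c))) _.
transitivity (kan_in qp (h (iC c))).
  rewrite -[h (iC c)]h'E.
  rewrite -(@kan_in_eq R F _ _ _ (eincl oB BV) _ q (plot_comp (eincl oB BV) qp) qp) //.
  by apply: esym; apply: kan_in_eq; apply/funext => a; exact: gE.
rewrite -hE; congr P; exact: ecoord_inj.
Qed.
End KanLocal.

(** * The tangent constructions on an open covering *)

Section TangentEmbedding.
Variable R : realType.
Implicit Types (X Y Z : dflg R).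

Lemma Tmap_Tpi X Y (f : dhom X Y) z : Tpi Y (Tmap f z) = f (Tpi X z).
Proof. exact: (Lkan_map_Lbase (pihat R) f z). Qed.

Section Tkmap.
Variables (k : nat) (X Y : dflg R) (f : dhom X Y).
Fact Tkmap_subproof (i i' : 'I_k) (s : Tk k X) :
  Tpi Y (dcomp (Tmap f) (fibpow_proj (Tpi X) i) s) =
  Tpi Y (dcomp (Tmap f) (fibpow_proj (Tpi X) i') s).
Proof.
have E l : Tpi Y (dcomp (Tmap f) (fibpow_proj (Tpi X) l) s) =
    f (Tpi X (fibpow_proj (Tpi X) l s)) by exact: Tmap_Tpi.
by rewrite !E (fibpow_projE i i').
Qed.
Definition Tkmap : dhom (Tk k X) (Tk k Y) := fibpow_pair Tkmap_subproof.
End Tkmap.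

Lemma fibpow_ext k X Y (f : dhom X Y) (s t : fibpow k f) :
  (forall i, fibpow_proj f i s = fibpow_proj f i t) -> s = t.
Proof. by move=> st; apply: val_inj; apply/funext. Qed.

Variables (X Y : dflg R) (j : dhom Y X).
Hypothesis embj : open_embedding j.

Lemma open_embedding_Tmap : open_embedding (Tmap j).
Proof. exact: (open_embedding_Lkan_map (@local_That R) embj). Qed.

Lemma range_Tmap z : range (Tmap j) z <-> range j (Tpi X z).
Proof. exact: (range_Lkan_map (@local_That R) embj). Qed.

(** The components of a point of [Tk k X] share their base point, so one index [i0]
decides; this is why [k] has to be positive. *)
Lemma range_Tkmap k (i0 : 'I_k) (s : Tk k X) :
  range (Tkmap k j) s <-> range j (Tpi X (fibpow_proj (Tpi X) i0 s)).
Proof.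
split=> [[t _ <-]|js].
  exists (Tpi Y (fibpow_proj (Tpi Y) i0 t)) => //; apply: esym.
  exact: (Tmap_Tpi j (fibpow_proj (Tpi Y) i0 t)).
have /choice[t tE] i : exists y, Tmap j y = fibpow_proj (Tpi X) i s.
  have [|y _ yE] := (range_Tmap (fibpow_proj (Tpi X) i s)).2; last by exists y.
  by rewrite (fibpow_projE i i0).
have tP : fibpow_set (Tpi Y) t.
  by move=> i i'; apply: embj.1.1; rewrite -!Tmap_Tpi !tE; exact: fibpow_projE.
by exists (exist _ t (mem_set tP)) => //; apply: fibpow_ext => i; exact: tE.
Qed.

Lemma open_embedding_Tkmap k : (0 < k)%N -> open_embedding (Tkmap k j).
Proof.
move=> k0; split; last first.
  rewrite (_ : range _ =
      dcomp (Tpi X) (fibpow_proj (Tpi X) (Ordinal k0)) @^-1` range j).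
    exact: open_dhom_preimage embj.2.
  by apply/seteqP; split=> s /(range_Tkmap (Ordinal k0)).
have [injT indT] := open_embedding_Tmap.1.
split=> [s t st|U p jp i].
  apply: fibpow_ext => i; apply: injT.
  exact: (f_equal (fibpow_proj (Tpi X) i) st).
by apply: indT; exact: (jp i).
Qed.
End TangentEmbedding.

Section TangentCovering.
Variables (R : realType) (I : Type) (X : dflg R) (Y : I -> dflg R).
Variable j : forall i, dhom (Y i) X.
Hypothesis cov : open_covering j.

Lemma open_covering_Tmap : open_covering (fun i => Tmap (j i)).
Proof.
split=> [i|z]; first exact: open_embedding_Tmap (cov.1 i).
have [i ji] := cov.2 (Tpi X z); exists i; exact/(range_Tmap (cov.1 i)).
Qed.

Lemma open_covering_Tkmap k : (0 < k)%N -> open_covering (fun i => Tkmap k (j i)).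
Proof.
move=> k0; split=> [i|s]; first exact: open_embedding_Tkmap (cov.1 i) _ k0.
have [i ji] := cov.2 (Tpi X (fibpow_proj (Tpi X) (Ordinal k0) s)).
by exists i; apply/(range_Tkmap (cov.1 i)); exact: ji.
Qed.
End TangentCovering.

Lemma open_covering_iterTk (R : realType) (I : Type) (X : dflg R) (Y : I -> dflg R)
    (j : forall i, dhom (Y i) X) (ks : seq nat) : all (leq 1) ks -> open_covering j ->
  exists j' : forall i, dhom (iterTk ks (Y i)) (iterTk ks X), open_covering j'.
Proof.
elim: ks => [|k ks IH] /=; first by move=> _ cov; exists j.
by move=> /andP[k0 ksP] cov; have [j' cov'] := IH ksP cov;
   exists (fun i => Tkmap k (j' i)); exact: open_covering_Tkmap.
Qed.

(** * Elasticity is local *)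

Section Elastic2.
Variables (R : realType) (X : dflg R).

Lemma theta2_surj (x : Tan (Tan X)) : exists z, theta2 X z = x.
Proof.
pose pt : eucl R := @Eucl R 0 setT openT.
have [A [oA [AW [Aw [Q [_ QE]]]]]] :=
  mu_lift (@local_That R) (plot_cst pt x) (@mkpt R pt 0 I).
by exists (Q (@mkpt R (Eucl oA) _ Aw)); exact: QE.
Qed.

(** As [theta2] is a subduction, morphisms out of [Tan (Tan X)] are the morphisms out
of [Lkan (T2hat R) X] that are constant on the fibres of [theta2]. *)
Lemma elastic2P : elastic2 X <-> forall z z', theta2 X z = theta2 X z' ->
  theta2 X (Lnat (tauhat R) X z) = theta2 X (Lnat (tauhat R) X z').
Proof.
split=> [[tau tauE] z z' zz'|ker]; first by rewrite -!tauE zz'.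
have /choice[s sE] := theta2_surj.
(* The choice of the section [s] does not matter, by [ker]; smoothness of [tau] comes
   from the smooth local lifts [Q]. *)
pose tau x := theta2 X (Lnat (tauhat R) X (s x)).
have tauE z : tau (theta2 X z) = theta2 X (Lnat (tauhat R) X z).
  by apply: ker; exact: sE.
have Stau (U : eucl R) (p : U -> Tan (Tan X)) : plot p -> plot (tau \o p : U -> Tan (Tan X)).
  move=> pp; apply: plot_local_pt => u.
  have [A [oA [AU [Au [Q [Qp QE]]]]]] := mu_lift (@local_That R) pp u.
  exists A, oA, AU; split=> //.
  rewrite (_ : _ \o _ = dcomp (theta2 X) (Lnat (tauhat R) X) \o Q).
    exact: dhomP.
  apply/funext => a; rewrite /= -[RHS]tauE; congr tau; exact: (esym (QE a)).
by exists (Dhom Stau).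
Qed.
End Elastic2.

Section Local.
Variables (R : realType) (I : Type) (X : dflg R) (Y : I -> dflg R).
Variable j : forall i, dhom (Y i) X.
Hypothesis cov : open_covering j.
Let covT := open_covering_Tmap cov.
Let covTT := open_covering_Tmap covT.
Let localT2 := local_functor_comp (@local_That R) (@local_That R).

Lemma Tpi_theta2 (Z : dflg R) (z : Lkan (T2hat R) Z) :
  Tpi Z (Tpi (Tan Z) (theta2 Z z)) = Lbase (comp_base (pihat R) (pihat R)) Z z.
Proof.
elim/kan_inW: z => U p pp w; rewrite [RHS]LbaseE.
rewrite (muE pp (w : That R (That R U))) TpiE.
exact: (TpiE pp).
Qed.

(** [theta2] preserves base points, so a point of the source comes from [Y i] as soon
as its image does. *)
Lemma theta2_lift i z : range (Tmap (Tmap (j i))) (theta2 X z) ->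
  range (Lkan_map (T2hat R) (j i)) z.
Proof.
move=> /(range_Tmap (covT.1 i)) /(range_Tmap (cov.1 i)).
rewrite Tpi_theta2 => jz.
by apply/(range_Lkan_map localT2 (cov.1 i)).
Qed.

Lemma theta2_nat i z :
  theta2 X (Lkan_map (T2hat R) (j i) z) = Tmap (Tmap (j i)) (theta2 (Y i) z).
Proof. exact: (Lkan_map_mu (F := That R) (G := That R) (j i) z). Qed.

Lemma elastic1_local : (forall i, elastic1 (Y i)) -> elastic1 X.
Proof.
move=> eY k k1; have k0 : (0 < k)%N by exact: ltnW.
have covk := open_covering_Tkmap cov k0.
have sq i z : theta k X (Lkan_map (Tkhat R k) (j i) z) =
    Tkmap k (j i) (theta k (Y i) z).
  by apply: fibpow_ext => l; exact: Lkan_map_Lnat.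
have baseE z : Tpi X (fibpow_proj (Tpi X) (Ordinal k0) (theta k X z)) =
    Lbase (tank_base R k) X z.
  elim/kan_inW: z => U p pp w; rewrite LbaseE.
  transitivity (Tpi X (Lnat (prhat R (Ordinal k0)) X (kan_in pp w))); first by [].
  rewrite LnatE TpiE; congr p; apply: ecoord_inj.
  transitivity (lsubmx (prhatf (Ordinal k0) (ecoord w))); first by [].
  by rewrite /prhatf row_mxKl.
apply/diso_inductionP; split.
  apply: (induction_local covk sq) => [i z|i].
    move=> /(range_Tkmap (cov.1 i) (Ordinal k0)); rewrite baseE.
    by move=> /(range_Lkan_map (@local_Tkhat R k) (cov.1 i)).
  by have /diso_inductionP[] := eY i k k1.
move=> s; have [i [t _ <-]] := covk.2 s.
have /diso_inductionP[_ surj] := eY i k k1; have [y _ <-] := surj t.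
by exists (Lkan_map (Tkhat R k) (j i) y).
Qed.

(** Two points with the same image under [theta2] have the same base point, hence lift
to the same member of the covering, where the kernel condition of [elastic2P] holds. *)
Lemma elastic2_local : (forall i, elastic2 (Y i)) -> elastic2 X.
Proof.
move=> eY; apply/elastic2P => z z' zz'; have [i jz] := covTT.2 (theta2 X z).
have [y _ yz] := theta2_lift jz.
have [y' _ yz'] : range (Lkan_map (T2hat R) (j i)) z'.
  by apply: theta2_lift; rewrite -zz'.
rewrite -yz -yz' !Lkan_map_Lnat !theta2_nat; congr (Tmap _ _).
apply: (elastic2P (Y i)).1 => //; apply: (covTT.1 i).1.1.
by rewrite -!theta2_nat yz yz'.
Qed.

(** [lambda] preserves base points, as [lambdahat w] lies over the zero vector at the
base point of [w]. *)
Lemma elastic3_local : (forall i, elastic3 (Y i)) -> elastic3 X.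
Proof.
move=> eY; apply: (induction_local (a := fun i => Tmap (j i)) covTT _ _ eY) => i z.
  transitivity (theta2 X (Lkan_map (T2hat R) (j i) (Lnat (lambdahat R) (Y i) z))).
    congr (theta2 X _).
    exact: (Lkan_map_Lnat (lambdahat R) (j i) z).
  exact: theta2_nat.
move=> /theta2_lift/(range_Lkan_map localT2 (cov.1 i)).
move=> jz; apply/(range_Tmap (cov.1 i)).
suff -> : Tpi X z = Lbase (comp_base (pihat R) (pihat R)) X (Lnat (lambdahat R) X z).
  exact: jz.
elim/kan_inW: z {jz} => U p pp w; rewrite TpiE LnatE [RHS]LbaseE; congr p.
apply: ecoord_inj.
transitivity (lsubmx (lsubmx (lambdahatf (ecoord w)))); last by [].
by rewrite /lambdahatf !row_mxKl.
Qed.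

Lemma nuE (Z : dflg R) k (l : 'I_k) (z : Tan (Tk k Z)) :
  fibpow_proj (Tmap (Tpi Z)) l (nu k Z z) = Tmap (fibpow_proj (Tpi Z) l) z.
Proof. by []. Qed.

(** One component of [nu] already determines the base point, so two points with equal
images lift to the same member; there all components can be compared because
[Tmap (Tmap (j i))] is injective. *)
Lemma elastic4_local : (forall i, elastic4 (Y i)) -> elastic4 X.
Proof.
move=> eY k k1 z z' zz'; have k0 : (0 < k)%N by exact: ltnW.
have covk := open_covering_Tkmap cov k0; have covTk := open_covering_Tmap covk.
pose pr l := Tmap (fibpow_proj (Tpi X) l) : dhom (Tan (Tk k X)) (Tan (Tan X)).
have prE l : pr l z = pr l z' := f_equal (fibpow_proj (Tmap (Tpi X)) l) zz'.
have [i jz] := covTk.2 z.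
have jz' : range (Tmap (Tkmap k (j i))) z'.
  move: jz => /(range_Tmap (covk.1 i))/(range_Tkmap (cov.1 i) (Ordinal k0)) jz.
  apply/(range_Tmap (covk.1 i))/(range_Tkmap (cov.1 i) (Ordinal k0)).
  rewrite -(Tmap_Tpi (fibpow_proj (Tpi X) (Ordinal k0))) in jz *.
  by rewrite -(Tmap_Tpi (fibpow_proj (Tpi X) (Ordinal k0))) -[Tmap _ z']prE.
have [y _ yz] := jz; have [y' _ yz'] := jz'.
have prj l x : pr l (Tmap (Tkmap k (j i)) x) =
    Tmap (Tmap (j i)) (Tmap (fibpow_proj (Tpi (Y i)) l) x).
  transitivity (Tmap (dcomp (Tmap (j i)) (fibpow_proj (Tpi (Y i)) l)) x).
    exact: Lkan_map_comp.
  by apply: esym; exact: Lkan_map_comp.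
rewrite -yz -yz'; congr (Tmap _ _); apply: (eY i k k1); apply: fibpow_ext => l.
rewrite !nuE; apply: (covTT.1 i).1.1.
by rewrite -!prj yz yz'.
Qed.
End Local.

(** The iterated spaces in the definition of elasticity are covered by those of the
members, so the local forms of the four axioms apply to each of them. *)
Lemma elastic_local (R : realType) (I : Type) (X : dflg R) (Y : I -> dflg R)
    (j : forall i, dhom (Y i) X) : open_covering j ->
  (forall i, elastic (Y i)) -> elastic X.
Proof.
move=> cov eY.
have eI ks : all (leq 1) ks ->
    [/\ elastic1 (iterTk ks X), elastic2 (iterTk ks X),
        elastic3 (iterTk ks X) & elastic4 (iterTk ks X)].
  move=> ksP; have [j' cov'] := open_covering_iterTk ksP cov.
  split.
  - by apply: (elastic1_local cov') => i; have [_ _ _ _ /(_ ks ksP)[]] := eY i.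
  - by apply: (elastic2_local cov') => i; have [_ _ _ _ /(_ ks ksP)[]] := eY i.
  - by apply: (elastic3_local cov') => i; have [_ _ _ _ /(_ ks ksP)[]] := eY i.
  - by apply: (elastic4_local cov') => i; have [_ _ _ _ /(_ ks ksP)[]] := eY i.
by have [] := eI [::] isT; split.
Qed.

Definition dsub_incl (R : realType) (X : dflg R) (S : set X) : dhom (dsub S) X :=
  @Dhom R (dsub S) X val (fun U p pp => pp).

Lemma range_dsub_incl (R : realType) (X : dflg R) (S : set X) :
  range (dsub_incl S) = S.
Proof.
apply/seteqP; split=> x; first by move=> [y _ <-]; exact: set_mem (valP y).
by move=> Sx; exists (exist _ x (mem_set Sx)).
Qed.

Lemma open_embedding_dsub_incl (R : realType) (X : dflg R) (S : set X) :
  open (S : set (Dspace X)) -> open_embedding (dsub_incl S).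
Proof.
move=> oS; split; last by rewrite range_dsub_incl.
by split=> [x y|U p //]; exact: val_inj.
Qed.

Theorem proposition4p6 (R : realType) (X : dflg R) :
  elastic X <->
  exists (I : Type) (S : I -> set X),
    is_open_cover S /\ forall i : I, elastic (dsub (S i)).
Proof.
split=> [eX|[I [S [[oS cS] eS]]]].
  exists unit, (fun=> setT); split.
    split=> [_|]; first exact: openT.
    by apply/seteqP; split=> // x _; exists tt.
  (* The total subspace is not literally [X], but [X] is an open covering of it. *)
  move=> _; pose f x : dsub (setT : set X) := exist _ x (mem_set (I : setT x)).
  have Sf (U : eucl R) (p : U -> X) : plot p -> plot (f \o p : U -> dsub setT) by [].
  apply: (@elastic_local R unit _ (fun=> X) (fun=> Dhom Sf)) => //.
  have rf : range (Dhom Sf) = setT.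
    by apply/seteqP; split=> // x _; exists (val x) => //; exact: val_inj.
  split=> [_|x]; last by exists tt; rewrite rf.
  split; last by rewrite rf; exact: openT.
  by split=> [x y /(f_equal val)|].
apply: (elastic_local (j := fun i => dsub_incl (S i))) eS; split=> [i|x].
  exact: open_embedding_dsub_incl.
have [i _ Six] : (\bigcup_i S i) x by rewrite cS.
by exists i; rewrite range_dsub_incl.
Qed.
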